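(* Let $G$ be a profinite group, let $X$ be a discrete $G$-spectrum and let $K$ be a closed subgroup of $G$. If $X$ is a hyperfibrant discrete $K$-spectrum, then there is a weak equivalence $$(X^{hH})^{hK/H}\simeq X^{hK},$$ where $H$ is any closed subgroup of $G$ that is also a normal subgroup of $K$.
   Context: Spectra are Bousfield–Friedlander spectra of simplicial sets. For a profinite group $G$, a discrete $G$-spectrum is a $G$-spectrum whose pointed simplicial sets are simplicial objects in discrete $G$-sets (sets with continuous action for the discrete topology). The category $\mathrm{Spt}_G$ of discrete $G$-spectra has a model structure in which a map is a weak equivalence (cofibration) iff it is one of underlying spectra. For $X\in\mathrm{Spt}_G$, $X\to X_{f,G}$ is a trivial cofibration to a fibrant object of $\mathrm{Spt}_G$, and $X^{hG}=(X_{f,G})^G$. For closed $K\le G$, $X$ is regarded as a discrete $K$-spectrum by restriction and $X^{hK}=(X_{f,K})^K$. If $U$ is open in $G$, a fibrant object of $\mathrm{Spt}_G$ is fibrant in $\mathrm{Spt}_U$, so one takes $X^{hU}=(X_{f,G})^U$. For $X\in\mathrm{Spt}_G$ and $K$ closed in $G$, the fibrant replacement $X_{f,G}\to(X_{f,G})_{f,K}$ in $\mathrm{Spt}_K$ induces the map $$\psi(X)_K^G\colon \operatorname{colim}_N X^{hNK}=\operatorname{colim}_N(X_{f,G})^{NK}\cong(X_{f,G})^K\to((X_{f,G})_{f,K})^K=X^{hK},$$ the colimit being over all open normal subgroups $N$ of $G$. A discrete $G$-spectrum $X$ is hyperfibrant if $\psi(X)_K^G$ is a weak equivalence for every closed subgroup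 $K$ of $G$. The same definition is used with $G$ replaced by any profinite group, in particular by $K$. Iterated homotopy fixed points: if $X$ is a hyperfibrant discrete $K$-spectrum and $H$ is a closed normal subgroup of $K$, then $\operatorname{colim}_NX^{hNH}=\operatorname{colim}_N(X_{f,K})^{NH}$ (colimit over open normal subgroups $N$ of $K$) is a discrete $K/H$-spectrum, weakly equivalent to $X^{hH}$ via $\psi(X)_H^K$; one identifies $X^{hH}$ with it and defines $(X^{hH})^{hK/H}=(\operatorname{colim}_NX^{hNH})^{hK/H}$. *)

(* Defs.v *)
From HB Require Import structures.
From Stdlib Require Import Relations.
From mathcomp Require Import all_boot generic_quotient ssralg ssrint all_classical.
From mathcomp Require Import topology_structure compact separation_axioms.
From mathcomp Require Import connected product_topology quotient_topology.
From mathcomp Require Import subspace_topology initial_topology subtype_topology.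

Set Implicit Arguments.
Unset Strict Implicit.
Unset Printing Implicit Defensive.

Local Open Scope quotient_scope.
Local Open Scope group_scope.
Local Open Scope classical_set_scope.

HB.mixin Record isProfiniteGroup G of Group G & Topological G := {
  mulg_continuous : continuous (fun p : G * G => p.1 * p.2);
  invg_continuous : continuous (fun x : G => x^-1);
  profinite_compact : compact [set: G];
  profinite_hausdorff : hausdorff_space G;
  profinite_totally_disconnected : totally_disconnected [set: G]
}.

#[short(type="profiniteGroupType")]
HB.structure Definition ProfiniteGroup :=
  {G of isProfiniteGroup G & Group G & Topological G}.

Lemma totally_disconnected_zero_dimensional (T : topologicalType) :
  compact [set: T] -> hausdorff_space T -> totally_disconnected [set: T] ->
  zero_dimensional T.
Proof.
move=> cT hT tdT x y xy.
pose Q := [set z | forall C : set T, clopen C -> C x -> C z].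
have Qx : Q x by [].
apply: contrapT => noU.
have Qy : Q y.
  move=> C cC Cx; apply: contrapT => nCy; apply: noU; exists C; split => //.
suff cQ : connected Q.
  have : connected_component [set: T] x y by exists Q.
  by rewrite tdT //= => yx; move: xy; rewrite yx eqxx.
have clQ : closed Q.
  have -> : Q = \bigcap_(C in [set C : set T | clopen C /\ C x]) C.
    by apply/seteqP; split => z /= Qz C; [case=> *; exact: Qz|move=> *; exact: Qz].
  by apply: closed_bigI => C [[]].
apply/connectedP => E [E0 QE [sE1 sE2]].
have clE b : closed (E b).
  move=> z cz.
  have Qz : Q z.
    by apply: clQ; apply: closureS cz => w Ew; rewrite QE; case: b Ew; [right|left].
  have zz b' : b' = ~~ b -> ~ E b' z.
    move=> -> Ez; case: b cz Ez => /= cz Ez.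
      by have : (E false `&` closure (E true)) z by []; rewrite sE2.
    by have : (closure (E false) `&` E true) z by []; rewrite sE1.
  by move: Qz; rewrite QE; case: b zz {cz} => /= zz [] // Ez; have := zz _ erefl Ez.
wlog [b Ebx] : / exists b, E b x.
  by apply; move: Qx; rewrite QE; case; [exists false|exists true].
have disj : E b `&` E (~~ b) = set0.
  rewrite -subset0 => z [Eb Enb].
  have [Ef Et] : E false z /\ E true z by case: b {Ebx} Eb Enb.
  by rewrite -sE1; split => //; exact: subset_closure.
have nT : normal_space T by exact: compact_normal.
have [U [oU EU cUE]] : exists U : set T, [/\ open U, E b `<=` U & closure U `<=` ~` E (~~ b)].
  have := nT _ (clE b) (~` E (~~ b)).
  case.
    apply/set_nbhsP; exists (~` E (~~ b)); split => //.
      exact: closed_openC.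
    by move=> z Ez Ez'; have : (E b `&` E (~~b)) z by []; rewrite disj.
  move=> V /set_nbhsP [W [oW EW WV]] cV; exists W; split => //.
  by apply: subset_trans cV; exact: closureS.
pose V := ~` closure U.
have oV : open V by apply: closed_openC; exact: closed_closure.
have [C [clC Cx CUV]] : exists C : set T, [/\ clopen C, C x & C `<=` U `|` V].
  have cK : compact (~` (U `|` V)).
    apply: (subclosed_compact _ cT) => //.
    by apply: open_closedC; exact: openU.
  pose F := filter_from [set D : set T | D x /\ clopen D] id.
  have FF : Filter F.
    apply: filter_from_filter; first by exists setT; split => //; exact: clopenT.
    by move=> A B [? ?] [? ?]; exists (A `&` B) => //; split=> //; exact: clopenI.
  have PF : ProperFilter F by apply: filter_from_proper; move=> ? [? _]; exists x.
  have /(iffLR (compact_near_coveringP _)) := cK.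
  move=> /(_ _ _ setC (powerset_filter_from_filter PF))[].
    move=> z nz.
    have nQz : ~ Q z.
      move=> Qz; apply: nz; move: Qz; rewrite QE => Qz.
      have [Ez|Ez] : E b z \/ E (~~ b) z.
        by case: Qz; case: (b) => /=; tauto.
      - by left; exact: EU.
      - by right => /cUE; exact.
    have [D [cD Dx Dz]] : exists D : set T, [/\ clopen D, D x & ~ D z].
      apply: contrapT => nD; apply: nQz => D cD Dx; apply: contrapT => Dz.
      by apply: nD; exists D.
    exists (~` D, [set U | U `<=` D]); first split.
    - by apply: open_nbhs_nbhs; split => //; apply: closed_openC; case: cD.
    - apply/near_powerset_filter_fromP; first by move=> ? ?; exact: subset_trans.
      by exists D => //; exists D.
    - by case=> i j [? /subsetC]; apply.
  move=> D [DF _ [C DC]] /(_ _ DC) h.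
  have [C' [C'x cC'] sC'] := DF _ DC.
  by exists C'; split => //; apply: subset_trans sC' _; move/subsetC: h; rewrite !setCK.
have cCU : clopen (C `&` U).
  case: clC => oC cC; split; first exact: openI.
  have -> : C `&` U = C `&` closure U.
    apply/seteqP; split => z [Cz Uz]; split => //; first exact: subset_closure.
    by case: (CUV _ Cz).
  by apply: closedI => //; exact: closed_closure.
have [w Ew] := E0 (~~ b).
have Qw : Q w by rewrite QE; case: (b) Ew => /= Ew; [left|right].
have [_ Uw] := Qw _ cCU (conj Cx (EU _ Ebx)).
by case: (cUE w (subset_closure Uw)).
Qed.

Record closedSubgroup (G : profiniteGroupType) := ClosedSubgroup {
  cs_set :> set G;
  cs_closed : closed cs_set;
  cs_1 : cs_set 1;
  cs_M : forall x y, cs_set x -> cs_set y -> cs_set (x * y);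
  cs_V : forall x, cs_set x -> cs_set x^-1
}.

Section Sub.
Variables (G : profiniteGroupType) (K : closedSubgroup G).

Definition csub : Type := set_type K.
HB.instance Definition _ := Topological.copy csub (set_type K).

Definition csval (x : csub) : G := set_val x.
Lemma csP (x : csub) : cs_set K (csval x). Proof. exact: set_valP. Qed.
Definition csmk (x : G) (Kx : cs_set K x) : csub := SigSub (mem_set Kx).
Lemma csmkK x (Kx : cs_set K x) : csval (csmk Kx) = x. Proof. by []. Qed.
Lemma csval_inj : injective csval. Proof. exact: val_inj. Qed.

Definition cs_one := csmk (cs_1 K).
Definition cs_mul (x y : csub) := csmk (cs_M (csP x) (csP y)).
Definition cs_inv (x : csub) := csmk (cs_V (csP x)).

Lemma cs_mulA : associative cs_mul.
Proof. by move=> x y z; apply: csval_inj; rewrite !csmkK mulgA. Qed.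
Lemma cs_mul1 : left_id cs_one cs_mul.
Proof. by move=> x; apply: csval_inj; rewrite !csmkK mul1g. Qed.
Lemma cs_mulV : left_inverse cs_one cs_inv cs_mul.
Proof. by move=> x; apply: csval_inj; rewrite !csmkK mulVg. Qed.
Lemma cs_mulg1 : right_id cs_one cs_mul.
Proof. by move=> x; apply: csval_inj; rewrite !csmkK mulg1. Qed.
Lemma cs_mulgV : right_inverse cs_one cs_inv cs_mul.
Proof. by move=> x; apply: csval_inj; rewrite !csmkK mulgV. Qed.

HB.instance Definition _ :=
  isGroup.Build csub cs_mulA cs_mul1 cs_mulg1 cs_mulV cs_mulgV.

Lemma csval_continuous : continuous csval.
Proof. exact: (@initial_continuous (set_type K) G set_val). Qed.

Lemma continuous_csval (T : topologicalType) (f : T -> csub) :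
  continuous (csval \o f) -> continuous f.
Proof.
move=> /continuousP cf; apply/continuousP => A [B oB <-].
by rewrite -comp_preimage; exact: cf.
Qed.

Lemma csM_continuous : continuous (fun p : csub * csub => p.1 * p.2).
Proof.
apply: continuous_csval => p.
apply: (@continuous_comp _ _ _ (fun p : csub * csub => (csval p.1, csval p.2))
  (fun p : G * G => p.1 * p.2)); last exact: mulg_continuous.
apply: cvg_pair => /=.
  by apply: (@cvg_comp _ _ _ fst csval); [exact: cvg_fst|exact: csval_continuous].
by apply: (@cvg_comp _ _ _ snd csval); [exact: cvg_snd|exact: csval_continuous].
Qed.

Lemma csV_continuous : continuous (fun x : csub => x^-1).
Proof.
apply: continuous_csval => x.
apply: (@continuous_comp _ _ _ csval (fun x : G => x^-1)).
  exact: csval_continuous.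
exact: invg_continuous.
Qed.

Lemma cs_hausdorff : hausdorff_space csub.
Proof.
rewrite open_hausdorff => x y xy.
have xy' : csval x != csval y by apply: contra_neq xy => /csval_inj.
have := @profinite_hausdorff G; rewrite open_hausdorff => /(_ _ _ xy').
case=> -[A B] /= [Ax By [oA oB AB]].
exists (csval @^-1` A, csval @^-1` B) => /=.
  by split; apply/mem_set; exact: set_mem.
split; [by exists A|by exists B|].
by rewrite -preimage_setI (eqP AB) preimage_set0.
Qed.

Lemma cs_compact : compact [set: csub].
Proof.
move=> F PF FT.
have cK : compact K.
  by apply: (subclosed_compact (@cs_closed _ K) (@profinite_compact G)).
have [|x [Kx cx]] := cK (csval @ F) (fmap_proper_filter csval PF).
  by apply: (@filterS _ F _ setT) filterT => y _; exact: csP.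
exists (csmk Kx); split => // A B FA.
move=> [_ /= [[V oV <-] Vx sVB]].
have [|y [[z Az <-] Vy]] := cx (csval @` A) V _ (open_nbhs_nbhs (conj oV Vx)).
  by apply: (@filterS _ F _ A) FA => z Az; exists z.
by exists z; split => //; exact: sVB.
Qed.

Lemma cs_totally_disconnected : totally_disconnected [set: csub].
Proof.
apply: zero_dimension_totally_disconnected => x y xy.
have xy' : csval x != csval y by apply: contra_neq xy => /csval_inj.
have [U [cU Ux Uy]] := totally_disconnected_zero_dimensional
  (@profinite_compact G) (@profinite_hausdorff G)
  (@profinite_totally_disconnected G) xy'.
exists (csval @^-1` U); split => //.
by apply: preimage_clopen => //; exact: csval_continuous.
Qed.

HB.instance Definition _ := isProfiniteGroup.Build csub
  csM_continuous csV_continuous cs_compact cs_hausdorff cs_totally_disconnected.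

End Sub.

Definition normal_subgroup (G : profiniteGroupType) (H : closedSubgroup G) :=
  forall g h, cs_set H h -> cs_set H (h ^ g).

Section Quotient.
Variables (G : profiniteGroupType) (H : closedSubgroup G).
Hypothesis nH : normal_subgroup H.

Definition coset_rel (x y : G) : bool := `[< cs_set H (x^-1 * y) >].

Lemma coset_rel_equiv : equiv_class_of coset_rel.
Proof.
split=> [x|x y|y x z].
- by apply/asboolP; rewrite mulVg; exact: cs_1.
- apply/asboolP/asboolP => /cs_V; by rewrite invgM invgK.
- move=> /asboolP xy /asboolP yz; apply/asboolP.
  by have := cs_M xy yz; rewrite mulgA mulgK.
Qed.
Canonical coset_equiv := EquivRelPack coset_rel_equiv.

Definition quotg (_ : normal_subgroup H) : Type :=
  quotient_topology {eq_quot coset_equiv}.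
Local Notation Q := (quotg nH).
HB.instance Definition _ :=
  Topological.copy Q (quotient_topology {eq_quot coset_equiv}).

Definition qproj (x : G) : Q := \pi_({eq_quot coset_equiv}) x.
Definition qrep (q : Q) : G := repr (q : {eq_quot coset_equiv}).

Lemma qrepK : cancel qrep qproj.
Proof. by move=> q; rewrite /qproj /qrep reprK. Qed.

Lemma qprojP x y : qproj x = qproj y <-> cs_set H (x^-1 * y).
Proof.
split=> [/eqmodP /asboolP //|Hxy]; apply/eqmodP; exact/asboolP.
Qed.

Lemma qrepP x : cs_set H (x^-1 * qrep (qproj x)).
Proof. by apply/qprojP; rewrite qrepK. Qed.

Definition q_mul (p q : Q) := qproj (qrep p * qrep q).
Definition q_inv (p : Q) := qproj (qrep p)^-1.

Lemma qprojM x y : q_mul (qproj x) (qproj y) = qproj (x * y).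
Proof.
symmetry; apply/qprojP.
have -> : (x * y)^-1 * (qrep (qproj x) * qrep (qproj y)) =
  ((x^-1 * qrep (qproj x)) ^ y) * (y^-1 * qrep (qproj y)).
  by rewrite /conjg invgM !mulgA mulgK.
by apply: cs_M (nH _ (qrepP x)) (qrepP y).
Qed.

Lemma qprojV x : q_inv (qproj x) = qproj x^-1.
Proof.
symmetry; apply/qprojP.
have -> : x^-1^-1 * (qrep (qproj x))^-1 = ((x^-1 * qrep (qproj x))^-1) ^ x^-1.
  by rewrite /conjg invgM !invgK !mulgA mulgK.
by apply/nH/cs_V/qrepP.
Qed.

Lemma qproj_ind (P : Q -> Prop) : (forall x, P (qproj x)) -> forall q, P q.
Proof. by move=> h q; rewrite -(qrepK q). Qed.

Lemma q_mulA : associative q_mul.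
Proof.
elim/qproj_ind=> x; elim/qproj_ind=> y; elim/qproj_ind=> z.
by rewrite !qprojM mulgA.
Qed.
Lemma q_mul1 : left_id (qproj 1) q_mul.
Proof. by elim/qproj_ind=> x; rewrite qprojM mul1g. Qed.
Lemma q_mulg1 : right_id (qproj 1) q_mul.
Proof. by elim/qproj_ind=> x; rewrite qprojM mulg1. Qed.
Lemma q_mulV : left_inverse (qproj 1) q_inv q_mul.
Proof. by elim/qproj_ind=> x; rewrite qprojV qprojM mulVg. Qed.
Lemma q_mulgV : right_inverse (qproj 1) q_inv q_mul.
Proof. by elim/qproj_ind=> x; rewrite qprojV qprojM mulgV. Qed.

HB.instance Definition _ :=
  isGroup.Build Q q_mulA q_mul1 q_mulg1 q_mulV q_mulgV.

Lemma qproj_mul x y : qproj x * qproj y = qproj (x * y).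
Proof. exact: qprojM. Qed.

Lemma qproj_inv x : (qproj x)^-1 = qproj x^-1.
Proof. exact: qprojV. Qed.

Lemma open_quotgP (U : set Q) : open U <-> open (qproj @^-1` U).
Proof. by []. Qed.

Lemma qproj_continuous : continuous qproj.
Proof. exact: (@pi_continuous G {eq_quot coset_equiv}). Qed.

Lemma translate_continuous (h : G) : continuous (fun x : G => x * h).
Proof.
move=> x; apply: (@continuous_comp _ _ _ (fun x => (x, h))
  (fun p : G * G => p.1 * p.2)); last exact: mulg_continuous.
by apply: cvg_pair; [exact: cvg_id|exact: cvg_cst].
Qed.

Lemma qproj_open (U : set G) : open U -> open (qproj @` U).
Proof.
move=> oU; apply/open_quotgP.
have -> : qproj @^-1` (qproj @` U) =
    \bigcup_(h in cs_set H) ((fun x => x * h) @^-1` U).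
  apply/seteqP; split=> x /=.
    by move=> [u Uu /esym/qprojP Hxu]; exists (x^-1 * u) => //=; rewrite mulVKg.
  move=> [h Hh Uxh]; exists (x * h) => //; apply/esym/qprojP.
  by rewrite mulKg.
apply: bigcup_open => h Hh.
by have /continuousP := @translate_continuous h; exact.
Qed.

Lemma qM_continuous : continuous (fun p : Q * Q => p.1 * p.2).
Proof.
move=> [p q]; rewrite -(qrepK p) -(qrepK q).
set x := qrep p; set y := qrep q.
move=> W; rewrite /= qproj_mul => nW.
have : nbhs (x * y) (qproj @^-1` W) by exact: qproj_continuous.
move=> /(@mulg_continuous G (x, y)) [[A B] /= [nA nB] AB].
have im z C : nbhs z C -> nbhs (qproj z) (qproj @` C).
  rewrite nbhsE => -[D [oD Dz] DC]; rewrite nbhsE.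
  exists (qproj @` D); last exact: image_subset.
  by split; [exact: qproj_open|exists z].
exists (qproj @` A, qproj @` B) => /=; first by split; exact: im.
move=> [_ _] /= [[a Aa <-] [b Bb <-]] /=.
by rewrite qproj_mul; exact: (AB (a, b)).
Qed.

Lemma qV_continuous : continuous (fun x : Q => x^-1).
Proof.
apply/continuousP => U oU; apply/open_quotgP.
have -> : qproj @^-1` ((fun x : Q => x^-1) @^-1` U) =
   (fun x : G => x^-1) @^-1` (qproj @^-1` U).
  by apply/seteqP; split=> x /=; rewrite qproj_inv.
have /continuousP := @invg_continuous G; apply.
exact/open_quotgP.
Qed.

Lemma q_compact : compact [set: Q].
Proof.
have -> : [set: Q] = qproj @` [set: G].
  by apply/seteqP; split=> // q _; exists (qrep q) => //; exact: qrepK.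
apply: continuous_compact; last exact: profinite_compact.
exact/continuous_subspaceT/qproj_continuous.
Qed.

Lemma q_zero_dimensional : zero_dimensional Q.
Proof.
elim/qproj_ind=> x; elim/qproj_ind=> y xy.
have cH : closed [set z | cs_set H (z^-1 * y)].
  have -> : [set z | cs_set H (z^-1 * y)] =
     (fun z => z^-1) @^-1` ((fun z => z * y) @^-1` (cs_set H)) by [].
  apply: closed_comp; first by move=> z _; exact: invg_continuous.
  apply: closed_comp; first by move=> z _; exact: translate_continuous.
  exact: cs_closed.
have nx : nbhs x (~` [set z | cs_set H (z^-1 * y)]).
  apply: open_nbhs_nbhs; split; first exact: closed_openC.
  by move=> /= Hxy; move: xy => /eqP; apply; apply/qprojP.
have zG := totally_disconnected_zero_dimensional
  (@profinite_compact G) (@profinite_hausdorff G)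
  (@profinite_totally_disconnected G).
have [C [Cx [oC cC]] sC] :=
  zero_dimensional_cvg (@profinite_hausdorff G) zG (@profinite_compact G) nx.
exists (qproj @` C); split; last 2 first.
- by exists x.
- by move=> [c Cc /qprojP]; exact: sC.
split; first exact: qproj_open.
(* the complement of the saturation C H is open since C and H are compact *)
rewrite -openC; apply/open_quotgP.
have cC' : compact C by exact: (subclosed_compact cC (@profinite_compact G)).
have cH' : compact (cs_set H).
  exact: (subclosed_compact (@cs_closed _ H) (@profinite_compact G)).
have -> : qproj @^-1` (~` (qproj @` C)) =
    ~` ((fun p : G * G => p.1 * p.2) @` (C `*` cs_set H)).
  apply/seteqP; split=> z /= nz.
    move=> [[c h] /= [Cc Hh] zE]; apply: nz; exists c => //.
    by apply/qprojP; rewrite -zE mulKg.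
  move=> [c Cc /qprojP Hcz]; apply: nz; exists (c, c^-1 * z) => //=.
  by rewrite mulVKg.
apply: closed_openC; apply: compact_closed; first exact: profinite_hausdorff.
apply: continuous_compact; last exact: compact_setX.
exact/continuous_subspaceT/mulg_continuous.
Qed.

Lemma q_hausdorff : hausdorff_space Q.
Proof.
rewrite open_hausdorff => p q /q_zero_dimensional [U [[oU cU] Up Uq]].
exists (U, ~` U) => /=; first by split; exact/mem_set.
by split=> //; [exact: closed_openC|rewrite setICr].
Qed.

Lemma q_totally_disconnected : totally_disconnected [set: Q].
Proof.
exact: zero_dimension_totally_disconnected q_zero_dimensional.
Qed.

HB.instance Definition _ := isProfiniteGroup.Build Q
  qM_continuous qV_continuous q_compact q_hausdorff q_totally_disconnected.

End Quotient.

(* T modulo the equivalence relation generated by R; an element is a class,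
   seen as a subset of T. *)
Section Quot.
Variables (T : Type) (R : T -> T -> Prop).
Definition Quot := {C : set T | exists x, C = [set y | clos_refl_sym_trans T R x y]}.
Definition cls (x : T) : Quot := exist _ _ (ex_intro _ x erefl).

Lemma cls_eqP x y : cls x = cls y <-> clos_refl_sym_trans T R x y.
Proof.
split=> [[] /(congr1 (fun C : set T => C y)) /= ->|xy]; first exact: rst_refl.
apply: eq_exist; apply/seteqP; split=> z /= h; last exact: rst_trans h.
by apply: rst_trans h; exact: rst_sym.
Qed.

Lemma cls_eq x y : R x y -> cls x = cls y.
Proof. by move=> Rxy; apply/cls_eqP/rst_step. Qed.

Lemma cls_ind (P : Quot -> Prop) : (forall x, P (cls x)) -> forall q, P q.
Proof. by move=> h [C [x E]]; subst C; exact: h. Qed.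

Lemma cls_surj (q : Quot) : exists x, cls x = q.
Proof. by elim/cls_ind: q => x; exists x. Qed.

Definition qlift (U : Type) (f : T -> U)
  of (forall x y, R x y -> f x = f y) : Quot -> U :=
  fun q => f (projT1 (cid (cls_surj q))).

Lemma qliftE U f (h : forall x y, R x y -> f x = f y) x :
  qlift (U := U) h (cls x) = f x.
Proof.
have lift a b : clos_refl_sym_trans T R a b -> f a = f b.
  by elim=> {a b} [a b|//|//|a b c _ -> _ ->]; first exact: h.
by rewrite /qlift; case: cid => y /= /cls_eqP /lift.
Qed.
End Quot.

Record simp m n := Simp {
  simp_fun :> 'I_m.+1 -> 'I_n.+1;
  simp_mono : forall i j : 'I_m.+1, i <= j -> simp_fun i <= simp_fun j }.

Lemma simp_eq m n (f g : simp m n) : f =1 g -> f = g.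
Proof.
case: f g => [f hf] [g hg] /= /funext fg; subst g.
by congr Simp; exact: Prop_irrelevance.
Qed.

Definition simp_id n : simp n n := @Simp n n id (fun _ _ h => h).
Definition simp_comp l m n (g : simp m n) (f : simp l m) : simp l n :=
  @Simp l n (g \o f) (fun i j h => simp_mono g (simp_mono f h)).
Definition simp_cst m n (c : 'I_n.+1) : simp m n :=
  @Simp m n (fun=> c) (fun _ _ _ => leqnn c).

Record sset := SSet {
  ssimp :> nat -> Type;
  sact : forall m n, simp m n -> ssimp n -> ssimp m;
  sact_id : forall n (x : ssimp n), sact (simp_id n) x = x;
  sact_comp : forall l m n (g : simp m n) (f : simp l m) (x : ssimp n),
    sact (simp_comp g f) x = sact f (sact g x) }.

Record smap (A B : sset) := SMap {
  smap_fun :> forall n, A n -> B n;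
  smap_nat : forall m n (f : simp m n) (x : A n),
    @smap_fun m (sact f x) = sact f (@smap_fun n x) }.
Arguments smap_fun {A B} s n x.

Lemma smap_eq A B (f g : smap A B) : (forall n x, f n x = g n x) -> f = g.
Proof.
case: f g => [f hf] [g hg] /= fg.
have E : f = g by apply: functional_extensionality_dep => n; apply/funext => x.
by subst g; congr SMap; exact: Prop_irrelevance.
Qed.

Record psset := PSSet {
  pss :> sset;
  pt : forall n, pss n;
  pt_sact : forall m n (f : simp m n), sact f (pt n) = pt m }.

Record psmap (A B : psset) := PSMap {
  psmap_smap :> smap A B;
  psmap_pt : forall n, psmap_smap n (pt A n) = pt B n }.

Lemma psmap_eq (A B : psset) (f g : psmap A B) :
  (forall n x, f n x = g n x) -> f = g.
Proof.
case: f g => [f hf] [g hg] /= /smap_eq fg; subst g.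
by congr PSMap; exact: Prop_irrelevance.
Qed.

Definition smap_comp (A B C : sset) (g : smap B C) (f : smap A B) : smap A C.
Proof.
exists (fun n x => g n (f n x)) => m n u x.
abstract by rewrite !smap_nat.
Defined.

Definition psmap_id (A : psset) : psmap A A :=
  @PSMap A A (@SMap A A (fun n x => x) (fun _ _ _ _ => erefl)) (fun=> erefl).

Definition psmap_comp (A B C : psset) (g : psmap B C) (f : psmap A B) :
  psmap A C.
Proof.
exists (smap_comp g f) => n /=.
abstract by rewrite !psmap_pt.
Defined.

Definition std (n : nat) : sset.
Proof.
exists (fun k => simp k n) (fun l k f x => simp_comp x f).
- abstract by move=> k x; exact: simp_eq.
- abstract by move=> *; exact: simp_eq.
Defined.

Definition sprod (A B : sset) : sset.
Proof.
exists (fun n => (A n * B n)%type) (fun m n f x => (sact f x.1, sact f x.2)).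
- abstract by move=> n [x y]; rewrite /= !sact_id.
- abstract by move=> *; rewrite /= !sact_comp.
Defined.

Definition ssum (A B : sset) : sset.
Proof.
exists (fun n => (A n + B n)%type) (fun m n f x =>
  match x with inl a => inl (sact f a) | inr b => inr (sact f b) end).
- abstract by move=> n [x|x]; rewrite sact_id.
- abstract by move=> l m n g f [x|x]; rewrite sact_comp.
Defined.

Definition dsum (I : Type) (F : I -> sset) : sset.
Proof.
exists (fun n => {i : I & F i n})
  (fun m n f x => existT _ (projT1 x) (sact f (projT2 x))).
- abstract by move=> n [i x]; rewrite /= sact_id.
- abstract by move=> l m n g f [i x]; rewrite /= sact_comp.
Defined.

(* The quotient of a simplicial set by the equivalence relation generated by a
   simplicial relation, pointed by the classes of the simplices p n. *)
Section SQuot.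
Variables (A : sset) (R : forall n, A n -> A n -> Prop).
Hypothesis Ract : forall m n (f : simp m n) x y,
  R x y -> R (sact f x) (sact f y).
Variable p : forall n, A n.
Hypothesis pact : forall m n (f : simp m n),
  clos_refl_sym_trans _ (@R m) (sact f (p n)) (p m).

Definition squot_act m n (f : simp m n) : Quot (@R n) -> Quot (@R m) :=
  @qlift _ _ _ (fun x => cls (@R m) (sact f x))
    (fun x y Rxy => cls_eq (Ract f Rxy)).

Lemma squot_actE m n (f : simp m n) x :
  squot_act f (cls _ x) = cls _ (sact f x).
Proof. exact: qliftE. Qed.

Definition squot_sset : sset.
Proof.
exists (fun n => Quot (@R n)) squot_act.
- abstract by move=> n; elim/cls_ind=> x; rewrite squot_actE sact_id.
- abstract by move=> l m n g f; elim/cls_ind=> x; rewrite !squot_actE sact_comp.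
Defined.

Definition squot : psset.
Proof.
exists squot_sset (fun n => cls _ (p n)) => m n f.
abstract by rewrite /= squot_actE; apply/cls_eqP.
Defined.

Variables (B : psset) (g : forall n, A n -> B n).
Hypothesis gact : forall m n (f : simp m n) x, g (sact f x) = sact f (g x).
Hypothesis gR : forall n (x y : A n), R x y -> g x = g y.
Hypothesis gp : forall n, g (p n) = pt B n.

Definition squot_lift : psmap squot B.
Proof.
unshelve refine (@PSMap squot B
  (@SMap squot B (fun n => qlift (@gR n)) _) _).
- abstract by move=> m n f; elim/cls_ind => x; rewrite /= squot_actE !qliftE gact.
- abstract by move=> n; rewrite /= qliftE gp.
Defined.

Lemma squot_liftE n x : squot_lift n (cls _ x) = g x.
Proof. exact: qliftE. Qed.
End SQuot.

(* S^1 = Delta^1 / boundary: the simplices of the boundary are the constant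
   maps [k] -> [1]. *)
Definition bdry1 k (x y : std 1 k) :=
  (exists c, x = simp_cst k c) /\ (exists c, y = simp_cst k c).

Lemma bdry1_act m n (f : simp m n) (x y : std 1 n) :
  bdry1 x y -> bdry1 (sact f x) (sact f y).
Proof.
by move=> [[c ->] [d ->]]; split; [exists c|exists d]; exact: simp_eq.
Qed.

Lemma bdry1_pt m n (f : simp m n) : clos_refl_sym_trans _ (@bdry1 m)
  (@sact (std 1) m n f (simp_cst n ord0)) (simp_cst m ord0).
Proof. by apply: rst_step; split; exists ord0 => //; exact: simp_eq. Qed.

Definition S1 : psset := squot bdry1_act bdry1_pt.

Definition S0 : psset.
Proof.
unshelve refine (@PSSet (@SSet (fun=> bool) (fun _ _ _ b => b) _ _)
  (fun=> false) _); by [].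
Defined.

Section Smash.
Variables A B : psset.

Definition wedge n (u : sprod A B n) := u.1 = pt A n \/ u.2 = pt B n.

(* the wedge is collapsed to the base point *)
Definition smash_rel n (u v : sprod A B n) := wedge u /\ wedge v.

Lemma smash_rel_act m n (f : simp m n) u v :
  smash_rel u v -> smash_rel (sact f u) (sact f v).
Proof.
have W w : wedge w -> wedge (@sact (sprod A B) _ _ f w).
  by case=> E; [left|right]; rewrite /= E pt_sact.
by move=> [/W ? /W].
Qed.

Lemma smash_pt m n (f : simp m n) : clos_refl_sym_trans _ (@smash_rel m)
  (@sact (sprod A B) m n f (pt A n, pt B n)) (pt A m, pt B m).
Proof. by rewrite /= !pt_sact; exact: rst_refl. Qed.

Definition smash : psset := squot smash_rel_act smash_pt.

Definition smk n (a : A n) (b : B n) : smash n := cls _ (a, b).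

Lemma smk_ptl n b : smk (pt A n) b = pt smash n.
Proof. by apply: cls_eq; split; left. Qed.
Lemma smk_ptr n a : smk a (pt B n) = pt smash n.
Proof. by apply: cls_eq; split; [right|left]. Qed.
Lemma smk_act m n (f : simp m n) a b :
  sact f (smk a b) = smk (sact f a) (sact f b).
Proof. exact: squot_actE. Qed.
Lemma smk_ind n (P : smash n -> Prop) :
  (forall a b, P (smk a b)) -> forall u, P u.
Proof. by move=> h; elim/cls_ind=> -[a b]; exact: h. Qed.

Variables (C : psset) (g : forall n, A n -> B n -> C n).
Hypothesis gact : forall m n (f : simp m n) a b,
  g (sact f a) (sact f b) = sact f (g a b).
Hypothesis gl : forall n b, g (pt A n) b = pt C n.
Hypothesis gr : forall n a, g a (pt B n) = pt C n.

Definition smash_lift : psmap smash C.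
Proof.
apply: (@squot_lift _ _ smash_rel_act _ smash_pt C (fun n u => g u.1 u.2)).
- abstract by move=> *; exact: gact.
- abstract by move=> n [a b] [c d] /= [] [] /= -> [] /= ->; rewrite !(gl, gr).
- abstract by move=> n; exact: gl.
Defined.

Lemma smash_liftE n (a : A n) (b : B n) : smash_lift n (smk a b) = g a b.
Proof. exact: qliftE. Qed.
End Smash.

Definition smash_map (A B B' : psset) (f : psmap B B') :
  psmap (smash A B) (smash A B').
Proof.
apply: (@smash_lift _ _ _ (fun n a b => smk a (f n b))).
- abstract by move=> *; rewrite smk_act smap_nat.
- abstract by move=> *; exact: smk_ptl.
- abstract by move=> *; rewrite psmap_pt smk_ptr.
Defined.

Lemma smash_mapE (A B B' : psset) (f : psmap B B') n (a : A n) b :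
  smash_map A f n (smk a b) = smk a (f n b).
Proof. exact: smash_liftE. Qed.

Section Pushout.
Variables (A B C : psset) (f : psmap A B) (g : psmap A C).

Definition pushout_rel n (u v : ssum B C n) :=
  exists a, u = inl (f n a) /\ v = inr (g n a).

Lemma pushout_rel_act m n (h : simp m n) u v :
  pushout_rel u v -> pushout_rel (sact h u) (sact h v).
Proof.
by move=> [a [-> ->]]; exists (sact h a); rewrite /= !smap_nat.
Qed.

Lemma pushout_pt m n (h : simp m n) : clos_refl_sym_trans _ (@pushout_rel m)
  (@sact (ssum B C) m n h (inl (pt B n))) (inl (pt B m)).
Proof. by rewrite /= pt_sact; exact: rst_refl. Qed.

Definition pushout : psset := squot pushout_rel_act pushout_pt.

Variables (D : psset) (u : psmap B D) (v : psmap C D).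
Hypothesis uv : forall n a, u n (f n a) = v n (g n a).

Definition pushout_lift : psmap pushout D.
Proof.
apply: (@squot_lift _ _ pushout_rel_act _ pushout_pt D
  (fun n x => match x with inl b => u n b | inr c => v n c end)).
- abstract by move=> m n h [b|c] /=; rewrite smap_nat.
- abstract by move=> n _ _ [a [-> ->]]; exact: uv.
- abstract by move=> n; exact: psmap_pt.
Defined.
End Pushout.

(* The k-simplices of sd Delta^n, the nerve of the poset of nonempty subsets
   of [n]. *)
Record sdsimp n k := SdSimp {
  chain :> 'I_k.+1 -> {set 'I_n.+1};
  chain_neq0 : forall i, 0 < #|chain i|;
  chain_mono : forall i j : 'I_k.+1, i <= j -> chain i \subset chain j }.

Lemma sdsimp_eq n k (c d : sdsimp n k) : c =1 d -> c = d.
Proof.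
case: c d => [c h1 h2] [d h3 h4] /= /funext cd; subst d.
by congr SdSimp; exact: Prop_irrelevance.
Qed.

Definition sd (n : nat) : sset.
Proof.
exists (fun k => sdsimp n k) (fun l k (f : simp l k) (c : sdsimp n k) =>
  @SdSimp n l (c \o f) (fun i => chain_neq0 c (f i))
    (fun i j h => chain_mono c (simp_mono f h))).
- abstract by move=> k c; exact: sdsimp_eq.
- abstract by move=> *; exact: sdsimp_eq.
Defined.

Definition sd_map m n (f : simp m n) : smap (sd m) (sd n).
Proof.
unshelve refine (@SMap (sd m) (sd n) (fun k (c : sdsimp m k) =>
  @SdSimp n k (fun i => [set f x | x in chain c i]%SET) _ _) _).
- abstract (move=> i; have /card_gt0P [x xc] := chain_neq0 c i;
    by apply/card_gt0P; exists (f x); exact: imset_f).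
- abstract by move=> i j ij; apply: imsetS; exact: chain_mono.
- abstract by move=> l k g c; exact: sdsimp_eq.
Defined.

Lemma lastv_lt n (S : {set 'I_n.+1}) : \max_(x in S) x < n.+1.
Proof. by rewrite ltnS; apply/bigmax_leqP => x _; rewrite -ltnS. Qed.

(* the last vertex map sd Delta^n -> Delta^n *)
Definition lastv (n : nat) : smap (sd n) (std n).
Proof.
unshelve refine (@SMap (sd n) (std n) (fun k (c : sdsimp n k) =>
  @Simp k n (fun i => Ordinal (lastv_lt (chain c i))) _) _).
- abstract (move=> i j ij; have /fintype.subsetP sub := chain_mono c ij;
    by apply/bigmax_leqP => x /sub xc; apply: (leq_bigmax_cond x)).
- abstract by move=> l k g c; exact: simp_eq.
Defined.

Lemma lastv_nat m n (f : simp m n) k (c : sd m k) :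
  lastv n k (sd_map f k c) = simp_comp f (lastv m k c).
Proof.
apply: simp_eq => i; apply/val_inj => /=.
have [x xc xE] := eq_bigmax_cond (fun x : 'I_m.+1 => val x) (chain_neq0 c i).
apply/eqP; rewrite eqn_leq; apply/andP; split.
  apply/bigmax_leqP => _ /imsetP [y yc ->]; apply: simp_mono => /=.
  exact: (leq_bigmax_cond y).
apply: leq_trans (leq_bigmax_cond _ (imset_f f xc)).
by apply: simp_mono; rewrite /= xE.
Qed.

(* Kan's functor Ex *)
Section KanEx.
Variable A : psset.

Definition ex_act m n (f : simp m n) (u : smap (sd n) A) : smap (sd m) A :=
  smap_comp u (sd_map f).

Definition ex_sset : sset.
Proof.
exists (fun n => smap (sd n) A) ex_act.
- abstract (move=> n u; apply: smap_eq => k c /=; congr (u k _);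
    by apply: sdsimp_eq => i /=; exact: imset_id).
- abstract (move=> l m n g f u; apply: smap_eq => k c /=; congr (u k _);
    by apply: sdsimp_eq => i /=; exact: imset_comp).
Defined.

Definition ex_pt n : smap (sd n) A.
Proof.
exists (fun k _ => pt A k); abstract by move=> *; rewrite pt_sact.
Defined.

Definition Ex : psset.
Proof.
exists ex_sset ex_pt; abstract by move=> m n f; exact: smap_eq.
Defined.

Definition ex_eta_fun n (x : A n) : smap (sd n) A.
Proof.
exists (fun k c => sact (lastv n k c) x).
abstract by move=> l k f c; rewrite smap_nat /= sact_comp.
Defined.

Definition ex_eta : psmap A Ex.
Proof.
unshelve refine (@PSMap A Ex (@SMap A Ex ex_eta_fun _) _).
- abstract (move=> m n f x; apply: smap_eq => k c;
    by rewrite -[RHS]/(sact (lastv n k (sd_map f k c)) x) lastv_nat sact_comp).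
- abstract by move=> n; apply: smap_eq => k c /=; exact: pt_sact.
Defined.
End KanEx.

Definition ex_map (A B : psset) (f : psmap A B) : psmap (Ex A) (Ex B).
Proof.
unshelve refine (@PSMap (Ex A) (Ex B)
  (@SMap (Ex A) (Ex B) (fun n u => smap_comp f u) _) _).
- abstract by move=> m n g u; exact: smap_eq.
- abstract by move=> n; apply: smap_eq => k c /=; exact: psmap_pt.
Defined.

Lemma ex_eta_nat (A B : psset) (f : psmap A B) n x :
  ex_map f n (ex_eta A n x) = ex_eta B n (f n x).
Proof. by apply: smap_eq => k c /=; rewrite smap_nat. Qed.

(* B /\ Ex A -> Ex (B /\ A), from the last vertex map on the factor B *)
Section ExSmash.
Variables B A : psset.

Definition ex_smash_fun n (b : B n) (u : Ex A n) : Ex (smash B A) n.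
Proof.
exists (fun k c => smk (sact (lastv n k c) b) (u k c)).
abstract by move=> l k f c; rewrite smk_act !smap_nat -sact_comp.
Defined.

Definition ex_smash : psmap (smash B (Ex A)) (Ex (smash B A)).
Proof.
apply: (@smash_lift _ _ _ ex_smash_fun).
- abstract (move=> m n f b u; apply: smap_eq => k c;
    by rewrite -[RHS]/(smk (sact (lastv n k (sd_map f k c)) b)
        (u k (sd_map f k c))) lastv_nat sact_comp).
- abstract by move=> n u; apply: smap_eq => k c /=; rewrite pt_sact smk_ptl.
- abstract by move=> n b; apply: smap_eq => k c /=; rewrite smk_ptr.
Defined.

Lemma ex_smash_eta n b x :
  ex_smash n (smk b (ex_eta A n x)) = ex_eta _ n (smk b x).
Proof.
by rewrite smash_liftE; apply: smap_eq => k c; symmetry; exact: smk_act.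
Qed.
End ExSmash.

Lemma ex_smash_nat (B A A' : psset) (f : psmap A A') n (b : B n) u :
  ex_map (smash_map B f) n (ex_smash B A n (smk b u)) =
  ex_smash B A' n (smk b (ex_map f n u)).
Proof.
by rewrite !smash_liftE; apply: smap_eq => k c; exact: smash_mapE.
Qed.

Fixpoint exn j (A : psset) : psset := if j is i.+1 then Ex (exn i A) else A.

Fixpoint exn_map j (A B : psset) (f : psmap A B) : psmap (exn j A) (exn j B) :=
  match j with 0 => f | i.+1 => ex_map (exn_map i f) end.

Fixpoint exn_smash j (B A : psset) : psmap (smash B (exn j A)) (exn j (smash B A)) :=
  match j with
  | 0 => psmap_id (smash B A)
  | i.+1 => psmap_comp (ex_map (exn_smash i B A)) (ex_smash B (exn i A))
  end.

Lemma exn_smash_nat j (B A A' : psset) (f : psmap A A') n (b : B n) u :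
  exn_map j (smash_map B f) n (exn_smash j B A n (smk b u)) =
  exn_smash j B A' n (smk b (exn_map j f n u)).
Proof.
elim: j n b u => [|j IH] n b u; first exact: smash_mapE.
have key k v : exn_map j (smash_map B f) k (exn_smash j B A k v) =
    exn_smash j B A' k (smash_map B (exn_map j f) k v).
  by elim/smk_ind: v => b' x; rewrite IH smash_mapE.
transitivity (ex_map (exn_smash j B A') n (ex_map (smash_map B (exn_map j f)) n
    (ex_smash B (exn j A) n (smk b u)))); last by rewrite ex_smash_nat.
by apply: smap_eq => k c; exact: key.
Qed.

(* Ex^oo A = colim (A -> Ex A -> Ex^2 A -> ...) *)
Section ExInf.
Variable A : psset.

Definition exinf_rel n (u v : dsum (fun j => exn j A) n) :=
  exists j (x : exn j A n),
    u = existT _ j x /\ v = existT _ j.+1 (ex_eta (exn j A) n x).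

Lemma exinf_rel_act m n (f : simp m n) u v :
  exinf_rel u v -> exinf_rel (sact f u) (sact f v).
Proof.
by move=> [j [x [-> ->]]]; exists j, (sact f x); rewrite smap_nat.
Qed.

Lemma exinf_ptP m n (f : simp m n) : clos_refl_sym_trans _ (@exinf_rel m)
  (@sact (dsum (fun j => exn j A)) m n f (existT _ 0%N (pt A n)))
  (existT _ 0%N (pt A m)).
Proof. by rewrite /= pt_sact; exact: rst_refl. Qed.

Definition exinf : psset := squot exinf_rel_act exinf_ptP.

Definition exin j n (x : exn j A n) : exinf n := cls _ (existT _ j x).

Lemma exin_eta j n (x : exn j A n) :
  exin (j := j.+1) (ex_eta (exn j A) n x) = exin x.
Proof. by symmetry; apply: cls_eq; exists j, x. Qed.

Lemma exin_pt j n : exin (pt (exn j A) n) = pt exinf n.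
Proof. by elim: j => // j <-; rewrite -[RHS]exin_eta psmap_pt. Qed.

Lemma exin_act m n (f : simp m n) j (x : exn j A n) :
  sact f (exin x) = exin (sact f x).
Proof. exact: squot_actE. Qed.

Lemma exin_ind n (P : exinf n -> Prop) :
  (forall j (x : exn j A n), P (exin x)) -> forall q, P q.
Proof. by move=> h; elim/cls_ind=> -[j x]; exact: h. Qed.
End ExInf.

Lemma exn_map_eta j (A B : psset) (f : psmap A B) n (x : exn j A n) :
  exn_map j.+1 f n (ex_eta _ n x) = ex_eta _ n (exn_map j f n x).
Proof. exact: ex_eta_nat. Qed.

Definition exinf_map (A B : psset) (f : psmap A B) : psmap (exinf A) (exinf B).
Proof.
apply: (@squot_lift _ _ (@exinf_rel_act A) _ (@exinf_ptP A) (exinf B)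
  (fun n u => exin (exn_map (projT1 u) f n (projT2 u)))).
- abstract by move=> m n g [j x]; rewrite exin_act smap_nat.
- abstract (by move=> n _ _ [j [x [-> ->]]];
    rewrite -[RHS]/(exin (exn_map j.+1 f n _)) exn_map_eta exin_eta).
- abstract by move=> n /=; rewrite psmap_pt exin_pt.
Defined.

Lemma exinf_mapE (A B : psset) (f : psmap A B) j n (x : exn j A n) :
  exinf_map f n (exin x) = exin (exn_map j f n x).
Proof. exact: qliftE. Qed.

Lemma exn_smash_eta j (B A : psset) n (b : B n) (x : exn j A n) :
  exn_smash j.+1 B A n (smk b (ex_eta (exn j A) n x)) =
  ex_eta _ n (exn_smash j B A n (smk b x)).
Proof.
by rewrite -[LHS]/(ex_map (exn_smash j B A) n (ex_smash _ _ n (smk b _)))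
  ex_smash_eta ex_eta_nat.
Qed.

Definition exinf_smash_fun (B A : psset) n (b : B n) : exinf A n -> exinf (smash B A) n.
Proof.
apply: (@qlift _ _ _ (fun u =>
  exin (exn_smash (projT1 u) B A n (smk b (projT2 u))))).
abstract (by move=> _ _ [j [x [-> ->]]];
  rewrite -[RHS]/(exin (exn_smash j.+1 B A n _)) exn_smash_eta exin_eta).
Defined.

Lemma exinf_smash_funE (B A : psset) n (b : B n) j (x : exn j A n) :
  exinf_smash_fun b (exin x) = exin (exn_smash j B A n (smk b x)).
Proof. exact: qliftE. Qed.

Definition exinf_smash (B A : psset) :
  psmap (smash B (exinf A)) (exinf (smash B A)).
Proof.
apply: (@smash_lift _ _ _ (@exinf_smash_fun B A)).
- abstract (move=> m n f b; elim/exin_ind=> j x;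
    by rewrite exin_act !exinf_smash_funE exin_act -smap_nat smk_act).
- abstract (move=> n; elim/exin_ind=> j x;
    by rewrite exinf_smash_funE smk_ptl psmap_pt exin_pt).
- abstract (by move=> n b; rewrite -(exin_pt A 0) exinf_smash_funE smk_ptr
    psmap_pt exin_pt).
Defined.

Lemma exinf_smashE (B A : psset) n (b : B n) j (x : exn j A n) :
  exinf_smash B A n (smk b (exin x)) = exin (exn_smash j B A n (smk b x)).
Proof. by rewrite smash_liftE exinf_smash_funE. Qed.

Lemma exinf_smash_nat (B A A' : psset) (f : psmap A A') n (b : B n) u :
  exinf_map (smash_map B f) n (exinf_smash B A n (smk b u)) =
  exinf_smash B A' n (smk b (exinf_map f n u)).
Proof.
elim/exin_ind: u => j x.
by rewrite exinf_smashE !exinf_mapE exinf_smashE exn_smash_nat.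
Qed.

Fixpoint sphere m : psset := if m is l.+1 then smash S1 (sphere l) else S0.

Definition homotopic (A B : psset) (f g : psmap A B) :=
  exists h : smap (sprod A (std 1)) B,
    [/\ forall n t, h n (pt A n, t) = pt B n,
        forall n x, h n (x, simp_cst n ord0) = f n x
      & forall n x, h n (x, simp_cst n ord_max) = g n x].

(* Bousfield-Friedlander spectra *)
Record spectrum := Spectrum {
  level :> nat -> psset;
  bond : forall n, psmap (smash S1 (level n)) (level n.+1) }.

Record spmap (X Y : spectrum) := SpMap {
  spmap_fun :> forall n, psmap (X n) (Y n);
  spmap_bond : forall n k (s : S1 k) (x : X n k),
    spmap_fun n.+1 k (bond X n k (smk s x)) =
    bond Y n k (smk s (spmap_fun n k x)) }.

Lemma spmap_bondE X Y (f : spmap X Y) n k u :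
  f n.+1 k (bond X n k u) = bond Y n k (smash_map S1 (f n) k u).
Proof. by elim/smk_ind: u => s x; rewrite spmap_bond smash_mapE. Qed.

Definition spmap_comp X Y Z (g : spmap Y Z) (f : spmap X Y) : spmap X Z.
Proof.
exists (fun n => psmap_comp (g n) (f n)).
abstract by move=> n k s x; rewrite /= !spmap_bond.
Defined.

(* X_(n+1) u_(S^1 /\ X_n) (S^1 /\ Y_n) -> Y_(n+1) *)
Definition cofib_map X Y (f : spmap X Y) n :
  psmap (pushout (bond X n) (smash_map S1 (f n))) (Y n.+1) :=
  pushout_lift (fun k u => spmap_bondE f u).

Definition cofibration X Y (f : spmap X Y) :=
  (forall k, injective (f 0%N k)) /\
  (forall n k, injective (cofib_map f n k)).

(* A simplicial set is replaced by the Kan complex Ex^oo to define its homotopy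
   groups: pi_m(X_n) = [S^m, Ex^oo X_n]_*. This is the stabilization map
   pi_m(X_n) -> pi_(m+1)(S^1 /\ X_n) -> pi_(m+1)(X_(n+1)) on representatives. *)
Definition suspend (X : spectrum) n m (a : psmap (sphere m) (exinf (X n))) :
  psmap (sphere m.+1) (exinf (X n.+1)) :=
  psmap_comp (exinf_map (bond X n))
    (psmap_comp (exinf_smash S1 (X n)) (smash_map S1 a)).

Record stable_rep (X : spectrum) (d : int) := StableRep {
  rep_level : nat;
  rep_dim : nat;
  rep_deg : (rep_dim%:Z = rep_level%:Z + d)%R;
  rep_map : psmap (sphere rep_dim) (exinf (X rep_level)) }.

Inductive stable_rel X d : stable_rep X d -> stable_rep X d -> Prop :=
| stable_homotopic n m (e : (m%:Z = n%:Z + d)%R)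
    (a b : psmap (sphere m) (exinf (X n))) :
    homotopic a b -> stable_rel (StableRep e a) (StableRep e b)
| stable_suspend n m (e : (m%:Z = n%:Z + d)%R) (e' : (m.+1%:Z = n.+1%:Z + d)%R)
    (a : psmap (sphere m) (exinf (X n))) :
    stable_rel (StableRep e a) (StableRep e' (suspend a)).

(* pi_d(X) = colim_n pi_(n+d)(X_n), for any integer d, as a set: bijectivity of
   the induced homomorphism does not involve the group structure. *)
Definition stable_pi (X : spectrum) (d : int) := Quot (@stable_rel X d).

Definition rep_push X Y (f : spmap X Y) d (r : stable_rep X d) :
  stable_rep Y d :=
  StableRep (rep_deg r)
    (psmap_comp (exinf_map (f (rep_level r))) (rep_map r)).

Lemma homotopic_comp A B C (g : psmap B C) (a b : psmap A B) :
  homotopic a b -> homotopic (psmap_comp g a) (psmap_comp g b).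
Proof.
move=> [h [hp h0 h1]]; exists (smap_comp g h); split=> n x /=.
- by rewrite hp psmap_pt.
- by rewrite h0.
- by rewrite h1.
Qed.

Lemma exinf_map_comp (A B C : psset) (g : psmap B C) (f : psmap A B) n x :
  exinf_map (psmap_comp g f) n x = exinf_map g n (exinf_map f n x).
Proof.
elim/exin_ind: x => j x; rewrite !exinf_mapE; congr exin.
elim: j n x => //= j IH n x; apply: smap_eq => k c /=; exact: IH.
Qed.

Lemma suspendE (X : spectrum) n m (a : psmap (sphere m) (exinf (X n))) k s x :
  suspend a k (smk s x) =
  exinf_map (bond X n) k (exinf_smash S1 (X n) k (smk s (a k x))).
Proof. by rewrite -smash_mapE. Qed.

Lemma suspend_nat X Y (f : spmap X Y) n m (a : psmap (sphere m) (exinf (X n))) :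
  psmap_comp (exinf_map (f n.+1)) (suspend a) =
  suspend (psmap_comp (exinf_map (f n)) a).
Proof.
apply: psmap_eq => k u; elim/smk_ind: u => s x.
rewrite -[LHS]/(exinf_map (f n.+1) k (suspend a k (smk s x))) !suspendE.
rewrite -[psmap_comp _ a k x]/(exinf_map (f n) k (a k x)) -exinf_smash_nat.
rewrite -!exinf_map_comp.
have -> // : psmap_comp (f n.+1) (bond X n) =
  psmap_comp (bond Y n) (smash_map S1 (f n)).
by apply: psmap_eq => l v; exact: spmap_bondE.
Qed.

Lemma rep_push_rel X Y (f : spmap X Y) d (r r' : stable_rep X d) :
  stable_rel r r' -> cls (@stable_rel Y d) (rep_push f r) = cls _ (rep_push f r').
Proof.
case=> [n m e a b ab|n m e e' a]; apply: cls_eq.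
  by apply: stable_homotopic; exact: homotopic_comp.
by rewrite /rep_push /= suspend_nat; exact: stable_suspend.
Qed.

Definition stable_pi_map X Y (f : spmap X Y) d : stable_pi X d -> stable_pi Y d :=
  qlift (@rep_push_rel X Y f d).

Definition stable_equiv X Y (f : spmap X Y) :=
  forall d, bijective (@stable_pi_map X Y f d).

(* related by a zigzag of stable equivalences *)
Definition weakly_equivalent : spectrum -> spectrum -> Prop :=
  clos_refl_sym_trans spectrum
    (fun X Y => exists f : spmap X Y, stable_equiv f).

(* The action is continuous on each discrete set X n k: it suffices that each
   orbit map G -> X n k be continuous. *)
Record dspt (G : profiniteGroupType) := DSpt {
  dspt_spectrum :> spectrum;
  gact : forall n k, G -> dspt_spectrum n k -> dspt_spectrum n k;
  gact1 : forall n k (x : dspt_spectrum n k), gact 1 x = x;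
  gactM : forall n k g h (x : dspt_spectrum n k),
    gact (g * h) x = gact g (gact h x);
  gact_sact : forall n l k (f : simp l k) g (x : dspt_spectrum n k),
    gact g (sact f x) = sact f (gact g x);
  gact_pt : forall n k g, gact g (pt (dspt_spectrum n) k) = pt _ k;
  gact_bond : forall n k g (s : S1 k) (x : dspt_spectrum n k),
    gact g (bond dspt_spectrum n k (smk s x)) =
    bond dspt_spectrum n k (smk s (gact g x));
  gact_continuous : forall n k (x y : dspt_spectrum n k),
    open [set g | gact g x = y] }.

Record dmap (G : profiniteGroupType) (X Y : dspt G) := DMap {
  dmap_spmap :> spmap X Y;
  dmap_gact : forall n k g (x : X n k),
    dmap_spmap n k (gact g x) = gact g (dmap_spmap n k x) }.

Definition trivial_cofibration G (A B : dspt G) (i : dmap A B) :=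
  cofibration i /\ stable_equiv i.

(* the right lifting property of X -> * against trivial cofibrations *)
Definition fibrant G (X : dspt G) :=
  forall (A B : dspt G) (i : dmap A B), trivial_cofibration i ->
  forall f : dmap A X, exists g : dmap B X,
  forall n k (a : A n k), g n k (i n k a) = f n k a.

Record fibrant_replacement G (X : dspt G) := FibrantReplacement {
  fr_obj : dspt G;
  fr_map : dmap X fr_obj;
  fr_trivial_cofibration : trivial_cofibration fr_map;
  fr_fibrant : fibrant fr_obj }.

(* a choice of X -> X_{f,G} for all G and X *)
Definition fibrant_replacements :=
  forall (G : profiniteGroupType) (X : dspt G), fibrant_replacement X.

Section Restriction.
Variables (G : profiniteGroupType) (K : closedSubgroup G) (X : dspt G).

Definition dres : dspt (csub K).
Proof.
exists (dspt_spectrum X) (fun n k (g : csub K) x => gact (csval g) x).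
- abstract by move=> n k x; exact: gact1.
- abstract by move=> n k g h x; exact: gactM.
- abstract by move=> n l k f g x; exact: gact_sact.
- abstract by move=> n k g; exact: gact_pt.
- abstract by move=> n k g s x; exact: gact_bond.
- abstract (move=> n k x y; exists [set g | gact g x = y] => //;
    exact: gact_continuous).
Defined.
End Restriction.

(* The fixed point spectrum X^S; S is any subset of G. *)
Section FixedPoints.
Variables (G : profiniteGroupType) (X : dspt G) (S : set G).

Definition fixed n k (x : X n k) := forall g, S g -> gact g x = x.

Definition fix_sset (n : nat) : sset.
Proof.
unshelve refine (@SSet (fun k => {x : X n k | fixed x})
  (fun l k f x => exist _ (sact f (sval x)) _) _ _).
- abstract by move=> g Sg; rewrite gact_sact (svalP x _ Sg).
- abstract by move=> k x; apply: eq_sig_hprop => [? ? ?|];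
    [exact: Prop_irrelevance|rewrite /= sact_id].
- abstract by move=> *; apply: eq_sig_hprop => [? ? ?|];
    [exact: Prop_irrelevance|rewrite /= sact_comp].
Defined.

Lemma fix_eq n k (x y : fix_sset n k) : sval x = sval y -> x = y.
Proof. by apply: eq_sig_hprop => ? ? ?; exact: Prop_irrelevance. Qed.

Lemma fix_ptP (n k : nat) : fixed (pt (X n) k).
Proof. by move=> g _; exact: gact_pt. Qed.

Definition fix_psset (n : nat) : psset.
Proof.
exists (fix_sset n) (fun k => exist _ _ (@fix_ptP n k)).
abstract by move=> *; apply: fix_eq; exact: pt_sact.
Defined.

Lemma fix_bondP n k (s : S1 k) (x : fix_psset n k) :
  fixed (bond X n k (smk s (sval x))).
Proof. by move=> g Sg; rewrite gact_bond (svalP x _ Sg). Qed.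

Definition fix_bond n : psmap (smash S1 (fix_psset n)) (fix_psset n.+1).
Proof.
apply: (@smash_lift S1 (fix_psset n) (fix_psset n.+1)
  (fun k s x => exist _ _ (fix_bondP s x))).
- abstract (by move=> l k f s x; apply: fix_eq;
    rewrite -[RHS]/(sact f (bond X n k (smk s (sval x)))) -smap_nat smk_act).
- abstract (by move=> k x; apply: fix_eq;
    rewrite -[LHS]/(bond X n k (smk _ _)) smk_ptl psmap_pt).
- abstract (by move=> k x; apply: fix_eq;
    rewrite -[LHS]/(bond X n k (smk x (pt _ k))) smk_ptr psmap_pt).
Defined.

Definition fixsp : spectrum := Spectrum fix_bond.

Lemma fix_bondE n k (s : S1 k) (x : fixsp n k) :
  sval (bond fixsp n k (smk s x)) = bond X n k (smk s (sval x)).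
Proof. by rewrite [bond fixsp n k _]smash_liftE. Qed.
End FixedPoints.

(* the restriction X^S -> Y^T of a map of spectra X -> Y *)
Section FixedMap.
Variables (G : profiniteGroupType) (X : dspt G) (S : set G).
Variables (L : profiniteGroupType) (Y : dspt L) (T : set L).
Variable f : spmap X Y.
Hypothesis fP : forall n k (x : X n k), fixed S x -> fixed T (f n k x).

Definition fix_map : spmap (fixsp X S) (fixsp Y T).
Proof.
unshelve refine (@SpMap (fixsp X S) (fixsp Y T) (fun n =>
  @PSMap (fixsp X S n) (fixsp Y T n) (@SMap (fixsp X S n) (fixsp Y T n)
    (fun k x => exist _ (f n k (sval x)) (fP (svalP x))) _) _) _).
- abstract by move=> l k h x; apply: fix_eq; rewrite /= smap_nat.
- abstract by move=> k; apply: fix_eq; rewrite /= psmap_pt.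
- abstract (move=> n k s x; apply: fix_eq;
    by rewrite fix_bondE -[LHS]/(f _ _ (sval _)) fix_bondE spmap_bond).
Defined.
End FixedMap.

Definition spmap_id (X : spectrum) : spmap X X.
Proof.
by exists (fun n => psmap_id (X n)).
Defined.

(* The colimit of a diagram of spectra indexed by a preorder with a least
   element i0, as in the case of the open normal subgroups ordered by reverse
   inclusion. *)
Section Colimit.
Variables (I : Type) (le : I -> I -> Prop) (i0 : I) (i0_le : forall i, le i0 i).
Variables (F : I -> spectrum) (u : forall i j, le i j -> spmap (F i) (F j)).

Definition colim_rel n k (x y : dsum (fun i => F i n) k) :=
  exists i j (ij : le i j) (z : F i n k),
    x = existT _ i z /\ y = existT _ j (u ij n k z).

Lemma colim_rel_act (n l k : nat) (f : simp l k) (x y : dsum (fun i => F i n) k) :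
  colim_rel x y -> colim_rel (sact f x) (sact f y).
Proof.
by move=> [i [j [ij [z [-> ->]]]]]; exists i, j, ij, (sact f z); rewrite smap_nat.
Qed.

Lemma colim_ptP (n l k : nat) (f : simp l k) : clos_refl_sym_trans _ (@colim_rel n l)
  (@sact (dsum (fun i => F i n)) l k f (existT _ i0 (pt (F i0 n) k)))
  (existT _ i0 (pt (F i0 n) l)).
Proof. by rewrite /= pt_sact; exact: rst_refl. Qed.

Definition colim_psset (n : nat) : psset := squot (@colim_rel_act n) (@colim_ptP n).

Definition colin i n k (x : F i n k) : colim_psset n k := cls _ (existT _ i x).

Lemma colin_le i j (ij : le i j) n k (x : F i n k) :
  colin (u ij n k x) = colin x.
Proof. by symmetry; apply: cls_eq; exists i, j, ij, x. Qed.

Lemma colin_act i n l k (f : simp l k) (x : F i n k) :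
  sact f (colin x) = colin (sact f x).
Proof. exact: squot_actE. Qed.

Lemma colin_pt i n k : colin (pt (F i n) k) = pt (colim_psset n) k.
Proof. by rewrite -(psmap_pt (u (i0_le i) n) k) colin_le. Qed.

Lemma colin_ind n k (P : colim_psset n k -> Prop) :
  (forall i (x : F i n k), P (colin x)) -> forall q, P q.
Proof. by move=> h; elim/cls_ind=> -[i x]; exact: h. Qed.

Definition colim_bond_fun n k (s : S1 k) : colim_psset n k -> colim_psset n.+1 k.
Proof.
apply: (@qlift _ _ _ (fun x => colin (bond (F (projT1 x)) n k (smk s (projT2 x))))).
abstract (by move=> _ _ [i [j [ij [z [-> ->]]]]] /=; rewrite -spmap_bond colin_le).
Defined.

Lemma colim_bond_funE n k (s : S1 k) i (x : F i n k) :
  colim_bond_fun s (colin x) = colin (bond (F i) n k (smk s x)).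
Proof. exact: qliftE. Qed.

Definition colim_bond n : psmap (smash S1 (colim_psset n)) (colim_psset n.+1).
Proof.
apply: (@smash_lift _ _ _ (@colim_bond_fun n)).
- abstract (move=> l k f s; elim/colin_ind=> i x;
    by rewrite colin_act !colim_bond_funE colin_act -smap_nat smk_act).
- abstract (move=> k; elim/colin_ind=> i x;
    by rewrite colim_bond_funE smk_ptl psmap_pt colin_pt).
- abstract (move=> k s;
    by rewrite -(colin_pt i0) colim_bond_funE smk_ptr psmap_pt colin_pt).
Defined.

Definition colim : spectrum := Spectrum colim_bond.

Lemma colim_bondE n k (s : S1 k) i (x : F i n k) :
  bond colim n k (smk s (colin x)) = colin (bond (F i) n k (smk s x)).
Proof. by rewrite [LHS]smash_liftE colim_bond_funE. Qed.

Variables (Z : spectrum) (g : forall i, spmap (F i) Z).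
Hypothesis gu : forall i j (ij : le i j) n k (x : F i n k),
  g j n k (u ij n k x) = g i n k x.

Definition colim_lift : spmap colim Z.
Proof.
unshelve refine (@SpMap colim Z (fun n => @squot_lift _ _ (@colim_rel_act n) _
  (@colim_ptP n) (Z n) (fun k x => g (projT1 x) n k (projT2 x)) _ _ _) _).
- abstract by move=> l k f [i x]; rewrite /= smap_nat.
- abstract by move=> k _ _ [i [j [ij [z [-> ->]]]]] /=; rewrite gu.
- abstract by move=> k /=; rewrite psmap_pt.
- abstract (move=> n k s; elim/colin_ind=> i x;
    by rewrite colim_bondE !squot_liftE /= spmap_bond).
Defined.
End Colimit.

Record openNormal (G : profiniteGroupType) := OpenNormal {
  on_set :> set G;
  on_open : open on_set;
  on_1 : on_set 1;
  on_M : forall x y, on_set x -> on_set y -> on_set (x * y);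
  on_V : forall x, on_set x -> on_set x^-1;
  on_J : forall g x, on_set x -> on_set (x ^ g) }.

Definition openNormalT (G : profiniteGroupType) : openNormal G :=
  @OpenNormal G setT openT Logic.I (fun _ _ _ _ => Logic.I)
    (fun _ _ => Logic.I) (fun _ _ _ => Logic.I).

(* colim_N (Z^{NH}), over the open normal subgroups N of G *)
Section ColimFix.
Variables (G : profiniteGroupType) (Z : dspt G) (H : set G).

Definition NH (N : openNormal G) : set G :=
  [set x * y | x in on_set N & y in H].

Definition on_le (N N' : openNormal G) := on_set N' `<=` on_set N.

Lemma on_leT N : on_le (openNormalT G) N. Proof. by []. Qed.

Lemma fix_NH N N' : on_le N N' ->
  forall n k (x : Z n k), fixed (NH N) x -> fixed (NH N') x.
Proof.
move=> le n k x fx _ [a N'a [h Hh <-]]; apply: fx.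
by exists a; [exact: le|exists h].
Qed.

Definition fix_incl N N' (le : on_le N N') :
  spmap (fixsp Z (NH N)) (fixsp Z (NH N')) :=
  fix_map (f := spmap_id Z) (fix_NH le).

Definition colim_fix : spectrum :=
  @colim _ on_le (openNormalT G) on_leT _ fix_incl.

Definition cfin (N : openNormal G) n k (x : fixsp Z (NH N) n k) :
  colim_fix n k := colin (openNormalT G) fix_incl x.

Lemma fixed_NH N : on_set N 1 -> forall n k (x : Z n k),
  fixed (NH N) x -> fixed H x.
Proof.
move=> N1 n k x fx h Hh; apply: fx; exists 1 => //; exists h => //.
by rewrite mul1g.
Qed.

(* colim_N (Z^{NH}) -> Z^H *)
Definition colim_fix_map : spmap colim_fix (fixsp Z H).
Proof.
apply: (@colim_lift _ _ _ _ _ _ _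
  (fun N => fix_map (f := spmap_id Z) (fixed_NH (@on_1 _ N)))).
abstract by move=> N N' le n k x; apply: fix_eq.
Defined.
End ColimFix.

Section Psi.
Variables (fr : fibrant_replacements).
Variables (G : profiniteGroupType) (X : dspt G) (K : closedSubgroup G).

Let XfG : dspt G := fr_obj (fr X).

Lemma fix_frP n k (x : XfG n k) : fixed (cs_set K) x ->
  fixed setT (fr_map (fr (dres K XfG)) n k x).
Proof.
move=> fx g _; rewrite -dmap_gact; congr (smap_fun _ _ _).
exact: fx (csP g).
Qed.

(* colim_N (X_{f,G})^{NK} -> (X_{f,G})^K -> ((X_{f,G})_{f,K})^K *)
Definition psi : spmap (colim_fix XfG (cs_set K))
    (fixsp (fr_obj (fr (dres K XfG))) setT) :=
  spmap_comp (fix_map fix_frP) (colim_fix_map XfG (cs_set K)).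
End Psi.

Definition hyperfibrant (fr : fibrant_replacements) G (X : dspt G) :=
  forall K : closedSubgroup G, stable_equiv (psi fr X K).

(* X^{hG} *)
Definition hfix (fr : fibrant_replacements) G (X : dspt G) : spectrum :=
  fixsp (fr_obj (fr G X)) setT.

(* colim_N (Z^{NH}) as a discrete G/H-spectrum, for H closed normal in G *)
Section ColimFixAction.
Variables (G : profiniteGroupType) (Z : dspt G) (H : closedSubgroup G).
Hypothesis nH : normal_subgroup H.

Lemma NH_J N g x : NH (cs_set H) N x -> NH (cs_set H) N (x ^ g).
Proof.
move=> [a Na [h Hh <-]]; exists (a ^ g); first exact: on_J.
by exists (h ^ g); [exact: nH|rewrite conjMg].
Qed.

Lemma fixed_gact N n k (x : Z n k) g :
  fixed (NH (cs_set H) N) x -> fixed (NH (cs_set H) N) (gact g x).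
Proof.
move=> fx a NHa; rewrite -gactM.
have -> : a * g = g * (a ^ g) by rewrite /conjg mulgA mulgV mul1g.
by rewrite gactM fx //; exact: NH_J.
Qed.

Definition cf_act_rep (g : G) n k (x : colim_fix Z (cs_set H) n k) :
  colim_fix Z (cs_set H) n k.
Proof.
move: x; apply: (@qlift _ _ _ (fun x => cfin
  (exist _ (gact g (sval (projT2 x))) (fixed_gact g (svalP (projT2 x)))))).
abstract (move=> _ _ [N [N' [le [z [-> ->]]]]];
  rewrite /cfin -(colin_le _ _ le); congr (colin _ _ _); exact: fix_eq).
Defined.

Lemma cf_act_repE (g : G) N n k (x : fixsp Z (NH (cs_set H) N) n k) :
  cf_act_rep g (cfin x) = cfin (exist _ _ (fixed_gact g (svalP x))).
Proof. exact: qliftE. Qed.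

Lemma cfin_ind n k (P : colim_fix Z (cs_set H) n k -> Prop) :
  (forall N (x : fixsp Z (NH (cs_set H) N) n k), P (cfin x)) -> forall q, P q.
Proof. exact: colin_ind. Qed.

Lemma cfin_eq N n k (x y : fixsp Z (NH (cs_set H) N) n k) :
  sval x = sval y -> cfin x = cfin y.
Proof. by move=> /fix_eq ->. Qed.

Lemma cf_act_rep_proj (g g' : G) n k (x : colim_fix Z (cs_set H) n k) :
  qproj nH g = qproj nH g' -> cf_act_rep g x = cf_act_rep g' x.
Proof.
move=> /qprojP Hgg; elim/cfin_ind: x => N x; rewrite !cf_act_repE.
apply: cfin_eq => /=.
have -> : g' = g * (g^-1 * g') by rewrite mulVKg.
rewrite gactM; congr (gact g _); symmetry.
exact: (fixed_NH (@on_1 _ N) (svalP x)).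
Qed.

Definition cf_act n k (q : quotg nH) := @cf_act_rep (qrep q) n k.

Lemma cf_actE (g : G) n k (x : colim_fix Z (cs_set H) n k) :
  cf_act (qproj nH g) x = cf_act_rep g x.
Proof. by apply: cf_act_rep_proj; rewrite qrepK. Qed.

Definition colim_fix_dspt : dspt (quotg nH).
Proof.
exists (colim_fix Z (cs_set H)) cf_act.
- abstract (move=> n k x; rewrite cf_actE; elim/cfin_ind: x => N x;
    by rewrite cf_act_repE; apply: cfin_eq; exact: gact1).
- abstract (move=> n k; elim/qproj_ind=> g; elim/qproj_ind=> h x;
    rewrite qproj_mul !cf_actE; elim/cfin_ind: x => N x;
    by rewrite !cf_act_repE; apply: cfin_eq; exact: gactM).
- abstract (move=> n l k f; elim/qproj_ind=> g x; rewrite !cf_actE;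
    elim/cfin_ind: x => N x;
    by rewrite cf_act_repE !colin_act cf_act_repE; apply: cfin_eq;
      exact: gact_sact).
- abstract (move=> n k; elim/qproj_ind=> g; rewrite cf_actE cf_act_repE;
    by apply: cfin_eq; exact: gact_pt).
- abstract (move=> n k; elim/qproj_ind=> g s x; rewrite !cf_actE;
    elim/cfin_ind: x => N x;
    by rewrite cf_act_repE !colim_bondE cf_act_repE; apply: cfin_eq;
      rewrite [RHS]fix_bondE -[LHS]/(gact g (sval (bond _ n k (smk s x))))
        fix_bondE gact_bond).
- abstract (move=> n k x y; elim/cfin_ind: x => N x; apply/open_quotgP;
    have -> : qproj nH @^-1` [set q : quotg nH | cf_act q (cfin x) = y] =
      \bigcup_(z in [set z : fixsp Z (NH (cs_set H) N) n k | cfin z = y])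
        [set g | gact g (sval x) = sval z];
    [ apply/seteqP; split=> g /=; rewrite cf_actE cf_act_repE;
      [ by move=> E; exists (exist _ _ (fixed_gact g (svalP x)))
      | by move=> [z <- E]; exact: cfin_eq ]
    | by apply: bigcup_open => z _; exact: gact_continuous ]).
Defined.
End ColimFixAction.

(* H as a closed subgroup of K *)
Definition sub_in (G : profiniteGroupType) (K H : closedSubgroup G) :
  closedSubgroup (csub K).
Proof.
exists [set x : csub K | cs_set H (csval x)].
- abstract (apply: closed_comp; [by move=> x _; exact: csval_continuous|];
    exact: cs_closed).
- abstract exact: cs_1.
- abstract by move=> x y; exact: cs_M.
- abstract by move=> x; exact: cs_V.
Defined.

(* (X^{hH})^{hG/H} *)
Definition iterated_hfix (fr : fibrant_replacements) (G : profiniteGroupType)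
    (X : dspt G) (H : closedSubgroup G) (nH : normal_subgroup H) : spectrum :=
  hfix fr (colim_fix_dspt (fr_obj (fr G X)) nH).

(* Main.v *)
(** Let Z be a fibrant replacement of X over K. Since Z is discrete, the colimit W
    of the Z^{NH} is just Z^H, and it is fibrant over K/H: taking H-fixed points
    is right adjoint to inflation, which preserves trivial cofibrations. Hence
    W -> W_f is a trivial cofibration between fibrant objects, and a Whitehead
    argument shows that it remains an equivalence on K/H-fixed points, while the
    K/H-fixed points of W are those of Z under K. *)

Require Import Defs.
From Stdlib Require Import Relations.
From mathcomp Require Import all_boot all_classical.
From mathcomp Require Import topology_structure compact separation_axioms.
From mathcomp Require Import product_topology subspace_topology.

Set Implicit Arguments.
Unset Strict Implicit.
Unset Printing Implicit Defensive.

Local Open Scope group_scope.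
Local Open Scope classical_set_scope.

(** * Functoriality of stable homotopy groups *)

Lemma stable_pi_mapE X Y (f : spmap X Y) d r :
  stable_pi_map f (cls (@stable_rel X d) r) = cls _ (rep_push f r).
Proof. exact: qliftE. Qed.

Lemma exinf_map_id A n x : exinf_map (psmap_id A) n x = x.
Proof.
elim/exin_ind: x => j x; rewrite exinf_mapE; congr exin.
elim: j n x => //= j IH n x; apply: smap_eq => k c /=; exact: IH.
Qed.

Lemma stable_pi_map_comp X Y Z (g : spmap Y Z) (f : spmap X Y) d x :
  stable_pi_map (spmap_comp g f) (d := d) x =
  stable_pi_map g (stable_pi_map f x).
Proof.
elim/cls_ind: x => r; rewrite !stable_pi_mapE; congr cls.
congr StableRep; apply: psmap_eq => k x; exact: exinf_map_comp.
Qed.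

(** Asking only for a map that is pointwise the identity makes this apply directly to a composite
    such as [spmap_comp g f]. *)
Lemma stable_pi_map_id X (f : spmap X X) :
  (forall n k x, f n k x = x) -> forall d, @stable_pi_map X X f d =1 id.
Proof.
move=> fE d; elim/cls_ind=> -[n m e a]; rewrite stable_pi_mapE; congr cls.
congr StableRep; apply: psmap_eq => k x /=.
have -> : f n = psmap_id (X n) by apply: psmap_eq => l y; rewrite fE.
exact: exinf_map_id.
Qed.

Lemma stable_pi_map_ext X Y (f g : spmap X Y) :
  (forall n k x, f n k x = g n k x) ->
  forall d, @stable_pi_map X Y f d =1 @stable_pi_map X Y g d.
Proof.
move=> fg d; elim/cls_ind=> -[n m e a]; rewrite !stable_pi_mapE; congr cls.
congr StableRep; apply: psmap_eq => k x /=.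
by have -> : f n = g n by apply: psmap_eq => l y; rewrite fg.
Qed.

Lemma stable_pi_map_cancel X Y (f : spmap X Y) (g : spmap Y X) :
  (forall n k x, g n k (f n k x) = x) ->
  forall d, cancel (@stable_pi_map X Y f d) (@stable_pi_map Y X g d).
Proof.
by move=> gf d x; rewrite -stable_pi_map_comp stable_pi_map_id.
Qed.

(** * Homotopies under Ex and Ex^oo, and levelwise homotopy equivalences *)

(** Ex preserves products, so Ex h is defined on Ex A x Ex Delta^1; the last vertex map supplies
    Delta^1 -> Ex Delta^1, and the composite is a homotopy on Ex A. *)
Definition ex_htpy_fun (A B : psset) (h : smap (sprod A (std 1)) B) n
  (u : Ex A n) (t : std 1 n) : Ex B n.
Proof.
exists (fun k c => h k (u k c, simp_comp t (lastv n k c))).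
abstract (by move=> l k f c; rewrite (smap_nat u) -(smap_nat h);
  congr (h _ (_, _)); exact: simp_eq).
Defined.

Definition ex_htpy (A B : psset) (h : smap (sprod A (std 1)) B) :
  smap (sprod (Ex A) (std 1)) (Ex B).
Proof.
exists (fun n ut => ex_htpy_fun h ut.1 ut.2).
abstract (move=> m n f [u t]; apply: smap_eq => k c;
  rewrite -[RHS]/(h k (u k (sd_map f k c), simp_comp t (lastv n k (sd_map f k c))))
    lastv_nat;
  congr (h k (_, _)); exact: simp_eq).
Defined.

Fixpoint exn_htpy j (A B : psset) (h : smap (sprod A (std 1)) B) :
  smap (sprod (exn j A) (std 1)) (exn j B) :=
  match j with 0 => h | i.+1 => ex_htpy (exn_htpy i h) end.

(** This compatibility with the maps of the tower is what lets the homotopies on the stages Ex^j A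
    descend to the colimit Ex^oo A. *)
Lemma exn_htpy_eta j (A B : psset) (h : smap (sprod A (std 1)) B) n x t :
  exn_htpy j.+1 h n (ex_eta (exn j A) n x, t) =
  ex_eta (exn j B) n (exn_htpy j h n (x, t)).
Proof. by apply: smap_eq => k c /=; rewrite -smap_nat. Qed.

(** The vertex [e] is arbitrary so that both ends of a homotopy are covered. *)
Lemma exn_htpy_cst j (A B : psset) (h : smap (sprod A (std 1)) B)
    (f : psmap A B) e :
  (forall n x, h n (x, simp_cst n e) = f n x) ->
  forall n x, exn_htpy j h n (x, simp_cst n e) = exn_map j f n x.
Proof.
move=> hf; elim: j => [|j IH] n x; first exact: hf.
by apply: smap_eq => k c /=; rewrite -IH; congr (exn_htpy j h k (_, _)).
Qed.

Definition exinf_htpy_fun (A B : psset) (h : smap (sprod A (std 1)) B) n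
  (t : std 1 n) : exinf A n -> exinf B n.
Proof.
apply: (@qlift _ _ _ (fun u => exin (exn_htpy (projT1 u) h n (projT2 u, t)))).
abstract (by move=> _ _ [j [x [-> ->]]];
  rewrite -[RHS]/(exin (exn_htpy j.+1 h n _)) exn_htpy_eta exin_eta).
Defined.

Lemma exinf_htpy_funE (A B : psset) (h : smap (sprod A (std 1)) B) n
    (t : std 1 n) j (x : exn j A n) :
  exinf_htpy_fun h t (exin x) = exin (exn_htpy j h n (x, t)).
Proof. exact: qliftE. Qed.

Lemma exinf_homotopic (T A B : psset) (f g : psmap A B)
    (a : psmap T (exinf A)) : homotopic f g ->
  homotopic (psmap_comp (exinf_map f) a) (psmap_comp (exinf_map g) a).
Proof.
move=> [h [hpt h0 h1]].
unshelve eexists (@SMap (sprod T (std 1)) (exinf B)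
  (fun n xt => exinf_htpy_fun h xt.2 (a n xt.1)) _).
  move=> m n s [x t].
  rewrite -[LHS]/(exinf_htpy_fun h (sact s t) (a m (sact s x))).
  rewrite -[RHS]/(sact s (exinf_htpy_fun h t (a n x))) smap_nat.
  elim/exin_ind: (a n x) => j y.
  by rewrite exin_act !exinf_htpy_funE exin_act -smap_nat.
split=> n x.
(* The base point of Ex^oo A is represented at stage 0, where the homotopy is [h] itself. *)
- rewrite -[LHS]/(exinf_htpy_fun h x (a n (pt T n))) psmap_pt -(exin_pt A 0).
  by rewrite exinf_htpy_funE /= hpt.
- rewrite -[LHS]/(exinf_htpy_fun h (simp_cst n ord0) (a n x)).
  rewrite -[RHS]/(exinf_map f n (a n x)); elim/exin_ind: (a n x) => j y.
  by rewrite exinf_htpy_funE exinf_mapE (exn_htpy_cst h0).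
- rewrite -[LHS]/(exinf_htpy_fun h (simp_cst n ord_max) (a n x)).
  rewrite -[RHS]/(exinf_map g n (a n x)); elim/exin_ind: (a n x) => j y.
  by rewrite exinf_htpy_funE exinf_mapE (exn_htpy_cst h1).
Qed.

(* The sections c need not commute with the bonding maps, but they do so up to
   homotopy since c p ~ id, and this is all that stable homotopy sees. *)
Lemma levelwise_stable_equiv X Y (p : spmap X Y)
    (c : forall n, psmap (Y n) (X n)) :
  (forall n k y, p n k (c n k y) = y) ->
  (forall n, homotopic (psmap_id (X n)) (psmap_comp (c n) (p n))) ->
  stable_equiv p.
Proof.
move=> pc cp d.
pose cpush (r : stable_rep Y d) : stable_rep X d :=
  StableRep (rep_deg r) (psmap_comp (exinf_map (c (rep_level r))) (rep_map r)).
have pcK n m (a : psmap (sphere m) (exinf (Y n))) :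
    psmap_comp (exinf_map (p n)) (psmap_comp (exinf_map (c n)) a) = a.
  apply: psmap_eq => k x.
  rewrite -[LHS]/(exinf_map (p n) k (exinf_map (c n) k (a k x))) -exinf_map_comp.
  have -> : psmap_comp (p n) (c n) = psmap_id (Y n).
    by apply: psmap_eq => l y /=; rewrite pc.
  exact: exinf_map_id.
have pushK (r : stable_rep Y d) : rep_push p (cpush r) = r.
  by case: r => n m e a; rewrite /rep_push /= pcK.
have cpushK (r : stable_rep X d) :
    cls (@stable_rel X d) (cpush (rep_push p r)) = cls _ r.
  case: r => n m e a; symmetry; apply: cls_eq.
  have {1}-> : a = psmap_comp (exinf_map (psmap_id (X n))) a.
    by apply: psmap_eq => k x; symmetry; exact: exinf_map_id.
  have -> : cpush (rep_push p (StableRep e a)) =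
      StableRep e (psmap_comp (exinf_map (psmap_comp (c n) (p n))) a).
    congr StableRep; apply: psmap_eq => k x; symmetry.
    exact: exinf_map_comp.
  by apply: stable_homotopic; exact: exinf_homotopic.
have crel (r r' : stable_rep Y d) : stable_rel r r' ->
    cls (@stable_rel X d) (cpush r) = cls _ (cpush r').
  case=> [n m e a b ab|n m e e' a].
    by apply: cls_eq; apply: stable_homotopic; exact: homotopic_comp.
  transitivity (cls (@stable_rel X d)
      (StableRep e' (suspend (psmap_comp (exinf_map (c n)) a)))).
    by apply: cls_eq; exact: stable_suspend.
  (* Applying c p does not change the class of the suspension of c a. Since p commutes with
     suspension and p c = id, the result is c applied to the suspension of a. *)
  rewrite -cpushK; congr cls; congr cpush; rewrite /rep_push /= suspend_nat.
  by rewrite pcK.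
exists (qlift crel); elim/cls_ind => r.
  by rewrite stable_pi_mapE qliftE cpushK.
by rewrite qliftE stable_pi_mapE pushK.
Qed.

(** * Pointed simplicial sets with a discrete G-action: quotients, smash products, pushouts,
    products *)

(** A single level of a discrete G-spectrum. The cylinder below is built by recursion on the level,
    before its bonding maps are available. *)
Record gpsset (G : profiniteGroupType) := GPSSet {
  gps :> psset;
  ga : forall k, G -> gps k -> gps k;
  ga1 : forall k (x : gps k), ga 1 x = x;
  gaM : forall k g h (x : gps k), ga (g * h) x = ga g (ga h x);
  ga_sact : forall l k (f : simp l k) g (x : gps k),
    ga g (sact f x) = sact f (ga g x);
  ga_pt : forall k g, ga g (pt gps k) = pt gps k;
  ga_open : forall k (x y : gps k), open [set g | ga g x = y] }.

Definition glevel G (X : dspt G) n : gpsset G :=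
  @GPSSet G (X n) (@gact G X n) (@gact1 G X n) (@gactM G X n)
    (@gact_sact G X n) (@gact_pt G X n) (@gact_continuous G X n).

Definition equivariant G (A B : gpsset G) (f : psmap A B) :=
  forall k g (x : A k), f k (ga g x) = ga g (f k x).

Section GQuot.
Variables (G : profiniteGroupType) (A : sset) (R : forall n, A n -> A n -> Prop).
Hypothesis Ract : forall m n (f : simp m n) x y,
  R x y -> R (sact f x) (sact f y).
Variable p : forall n, A n.
Hypothesis pact : forall m n (f : simp m n),
  clos_refl_sym_trans _ (@R m) (sact f (p n)) (p m).
Variable a : forall k, G -> A k -> A k.
Hypothesis a1 : forall k (x : A k), a 1 x = x.
Hypothesis aM : forall k g h (x : A k), a (g * h) x = a g (a h x).
Hypothesis a_sact : forall l k (f : simp l k) g (x : A k),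
  a g (sact f x) = sact f (a g x).
Hypothesis aR : forall k g (x y : A k), R x y -> R (a g x) (a g y).
Hypothesis a_pt : forall k g, a g (p k) = p k.
Hypothesis a_open : forall k (x y : A k), open [set g | a g x = y].

Definition gsquot_act k g : squot Ract pact k -> squot Ract pact k :=
  @qlift _ _ _ (fun x => cls (@R k) (a g x)) (fun x y Rxy => cls_eq (aR g Rxy)).

Lemma gsquot_actE k g (x : A k) : gsquot_act g (cls _ x) = cls _ (a g x).
Proof. exact: qliftE. Qed.

(** Discreteness passes to the quotient: the elements of G carrying the class of x to y form the
    union, over the representatives z of y, of the open sets of those carrying x to z. *)
Definition gsquot : gpsset G.
Proof.
exists (squot Ract pact) gsquot_act.
- abstract by move=> k; elim/cls_ind => x; rewrite gsquot_actE a1.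
- abstract by move=> k g h; elim/cls_ind => x; rewrite !gsquot_actE aM.
- abstract (by move=> l k f g; elim/cls_ind => x;
    rewrite /= squot_actE !gsquot_actE squot_actE a_sact).
- abstract by move=> k g; rewrite [LHS]gsquot_actE a_pt.
- abstract (move=> k x y; elim/cls_ind: x => x;
    have -> : [set g | gsquot_act g (cls _ x) = y] =
      \bigcup_(z in [set z | cls (@R k) z = y]) [set g | a g x = z];
    [ apply/seteqP; split=> g /=; rewrite gsquot_actE;
      [ by move=> E; exists (a g x) | by move=> [z <- ->] ]
    | by apply: bigcup_open => z _; exact: a_open ]).
Defined.
End GQuot.

Section GSmash.
Variables (G : profiniteGroupType) (B : psset) (A : gpsset G).

Definition gsmash_rep k (g : G) (u : sprod B A k) : sprod B A k :=
  (u.1, ga g u.2).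

Definition gsmash : gpsset G.
Proof.
apply: (@gsquot G _ _ (@smash_rel_act B A) _ (@smash_pt B A) gsmash_rep).
- abstract by move=> k [b x]; rewrite /gsmash_rep ga1.
- abstract by move=> k g h [b x]; rewrite /gsmash_rep gaM.
- abstract by move=> l k f g [b x]; rewrite /gsmash_rep /= ga_sact.
- abstract (move=> k g u v [wu wv];
    (have W w : wedge w -> wedge (gsmash_rep g w)
      by case=> E; [left; exact: E|right; rewrite /= E; exact: ga_pt]);
    by split; exact: W).
- abstract by move=> k g; rewrite /gsmash_rep ga_pt.
- abstract (move=> k [b x] [b' y];
    have [->|bb'] := pselect (b = b');
    [ have -> : [set g | gsmash_rep g (b', x) = (b', y)] = [set g | ga g x = y];
      [ by apply/seteqP; split=> g; rewrite /= /gsmash_rep /=; [case|move=> ->]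
      | exact: ga_open ]
    | have -> : [set g | gsmash_rep g (b, x) = (b', y)] = set0;
      [ by apply/seteqP; split=> g //= [/bb'] | exact: open0 ] ]).
Defined.

Lemma gsmash_actE k g (b : B k) (x : A k) :
  @ga G gsmash k g (smk b x) = smk b (ga g x).
Proof. exact: gsquot_actE. Qed.
End GSmash.

Section GPushout.
Variables (G : profiniteGroupType) (A B C : gpsset G).
Variables (f : psmap A B) (g : psmap A C).
Hypotheses (fG : equivariant f) (gG : equivariant g).

Definition gpushout_rep k (s : G) (u : ssum B C k) : ssum B C k :=
  match u with inl b => inl (ga s b) | inr c => inr (ga s c) end.

Definition gpushout : gpsset G.
Proof.
apply: (@gsquot G _ _ (@pushout_rel_act A B C f g) _ (@pushout_pt A B C f g)
  gpushout_rep).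
- abstract by move=> k [b|c]; rewrite /= ga1.
- abstract by move=> k s t [b|c]; rewrite /= gaM.
- abstract by move=> l k h s [b|c]; rewrite /= ga_sact.
- abstract by move=> k s _ _ [a [-> ->]]; exists (ga s a); rewrite /= fG gG.
- abstract by move=> k s; rewrite /= ga_pt.
- abstract (move=> k [x|x] [y|y];
    [ have -> : [set s | gpushout_rep s (inl x) = inl y] = [set s | ga s x = y];
      [ by apply/seteqP; split=> s /=; [case|move=> ->] | exact: ga_open ]
    | by have -> : [set s | gpushout_rep s (inl x) = inr y] = set0;
      [ by apply/seteqP; split | exact: open0 ]
    | by have -> : [set s | gpushout_rep s (inr x) = inl y] = set0;
      [ by apply/seteqP; split | exact: open0 ]
    | have -> : [set s | gpushout_rep s (inr x) = inr y] = [set s | ga s x = y];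
      [ by apply/seteqP; split=> s /=; [case|move=> ->] | exact: ga_open ] ]).
Defined.

Definition po_inl : psmap B gpushout.
Proof.
unshelve refine (@PSMap B gpushout (@SMap B gpushout
  (fun k b => cls _ (inl b)) _) _).
- abstract by move=> m n h b; rewrite [RHS]squot_actE.
- abstract by [].
Defined.

Definition po_inr : psmap C gpushout.
Proof.
unshelve refine (@PSMap C gpushout (@SMap C gpushout
  (fun k c => cls _ (inr c)) _) _).
- abstract by move=> m n h b; rewrite [RHS]squot_actE.
- abstract (move=> n; symmetry; apply: cls_eq; exists (pt A n);
    by rewrite !psmap_pt).
Defined.

Lemma po_glue k (x : A k) : po_inl k (f k x) = po_inr k (g k x).
Proof. by apply: cls_eq; exists x. Qed.

Lemma po_inl_equivariant : equivariant po_inl.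
Proof. by move=> k s x; symmetry; exact: gsquot_actE. Qed.

Lemma po_inr_equivariant : equivariant po_inr.
Proof. by move=> k s x; symmetry; exact: gsquot_actE. Qed.
End GPushout.

Definition pprod (A B : psset) : psset.
Proof.
exists (sprod A B) (fun n => (pt A n, pt B n)).
abstract by move=> m n f; rewrite /= !pt_sact.
Defined.

Definition gprod G (A B : gpsset G) : gpsset G.
Proof.
exists (pprod A B) (fun k g x => (ga g x.1, ga g x.2)).
- abstract by move=> k [x y]; rewrite /= !ga1.
- abstract by move=> k g h [x y]; rewrite /= !gaM.
- abstract by move=> l k f g [x y]; rewrite /= !ga_sact.
- abstract by move=> k g; rewrite /= !ga_pt.
- abstract (move=> k [x y] [x' y'];
    have -> : [set g : G | (ga g x, ga g y) = (x', y')] =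
      [set g | ga g x = x'] `&` [set g | ga g y = y'];
    [ by apply/seteqP; split=> g /= [-> ->]
    | by apply: openI; exact: ga_open ]).
Defined.

Definition pfst (A B : psset) : psmap (pprod A B) A :=
  @PSMap (pprod A B) A (@SMap (pprod A B) A (fun _ x => x.1)
    (fun _ _ _ _ => erefl)) (fun=> erefl).

Definition pair_psmap (T A B : psset) (f : psmap T A) (g : psmap T B) :
  psmap T (pprod A B).
Proof.
unshelve refine (@PSMap T (pprod A B) (@SMap T (pprod A B)
  (fun k x => (f k x, g k x)) _) _).
- abstract by move=> m n h x; rewrite /= !smap_nat.
- abstract by move=> n; rewrite /= !psmap_pt.
Defined.

(** * Cones and the cylinder of an equivariant map *)

(** The join Delta^1 x Delta^1 -> Delta^1, read as a homotopy from the identity of the interval to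
    the constant map at 1. *)
Definition std1_max k (s t : std 1 k) : std 1 k.
Proof.
exists (fun i => if s i <= t i then t i else s i).
abstract (move=> i j ij; have := simp_mono s ij; have := simp_mono t ij;
  case: (leqP (s i) (t i)); case: (leqP (s j) (t j)) => //= h1 h2 h3 h4;
  [ exact: leq_trans h3 (ltnW h1) | exact: leq_trans h4 h1 ]).
Defined.

Lemma std1_max0 k (s : std 1 k) : std1_max s (simp_cst k ord0) = s.
Proof.
by apply: simp_eq => i /=; case: ifP => //; rewrite leqn0 => /eqP s0; apply: val_inj.
Qed.

Lemma std1_max1 k (s : std 1 k) :
  std1_max s (simp_cst k ord_max) = simp_cst k ord_max.
Proof. by apply: simp_eq => i /=; rewrite -ltnS ltn_ord. Qed.

Lemma std1_1max k (s : std 1 k) :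
  std1_max (simp_cst k ord_max) s = simp_cst k ord_max.
Proof.
apply: simp_eq => i /=; case: ifP => // h; apply: val_inj => /=.
by apply/eqP; rewrite eqn_leq h -ltnS ltn_ord.
Qed.

(* The interval is pointed at 1, so that the cone is contracted by raising the
   interval coordinate, and x |-> (0, x) embeds A in its cone. *)
Definition I1 : psset.
Proof.
exists (std 1) (fun k => simp_cst k ord_max).
abstract by move=> m n f; exact: simp_eq.
Defined.

Notation cone A := (smash I1 A).

Definition cone_in (A : psset) : psmap A (cone A).
Proof.
unshelve refine (@PSMap A (cone A) (@SMap A (cone A)
  (fun k x => @smk I1 A k (simp_cst k ord0) x) _) _).
- abstract (move=> m n h x; rewrite smk_act; congr smk; exact: simp_eq).
- abstract by move=> n; exact: smk_ptr.
Defined.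

Lemma cone_in_inj (A : psset) k : injective (cone_in A k).
Proof.
(* A left inverse on k-simplices only; it need not be simplicial. It reads the second coordinate
   when the interval coordinate starts at 0, and is constant on the wedge because the interval is
   pointed at 1. *)
pose r (u : sprod I1 A k) : A k :=
  if u.1 ord0 == ord0 :> 'I_2 then u.2 else pt A k.
have rP u v : smash_rel u v -> r u = r v.
  have W w : wedge w -> r w = pt A k by rewrite /r; case=> -> //; case: ifP.
  by move=> [/W -> /W ->].
by move=> x y /(congr1 (qlift rP)); rewrite !qliftE.
Qed.

Definition cone_raise (A : psset) k (t : std 1 k) : cone A k -> cone A k.
Proof.
apply: (@qlift _ _ _ (fun u => @smk I1 A k (std1_max u.1 t) u.2)).
abstract ((have W (w : sprod I1 A k) : wedge w ->
    @smk I1 A k (std1_max w.1 t) w.2 = pt _ k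
  by case=> ->; rewrite ?smk_ptr // std1_1max; exact: smk_ptl);
  by move=> u v [/W -> /W ->]).
Defined.

Lemma cone_raiseE (A : psset) k (t : std 1 k) s (x : A k) :
  cone_raise t (@smk I1 A k s x) = @smk I1 A k (std1_max s t) x.
Proof. exact: qliftE. Qed.

Lemma cone_raise_act (A : psset) l k (f : simp l k) (t : std 1 k) (u : cone A k) :
  cone_raise (sact f t) (sact f u) = sact f (cone_raise t u).
Proof.
elim/smk_ind: u => s x; rewrite smk_act !cone_raiseE smk_act.
by congr smk; apply: simp_eq.
Qed.

Lemma cone_raise0 (A : psset) k (u : cone A k) : cone_raise (simp_cst k ord0) u = u.
Proof. by elim/smk_ind: u => s x; rewrite cone_raiseE std1_max0. Qed.

Lemma cone_raise1 (A : psset) k (u : cone A k) :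
  cone_raise (simp_cst k ord_max) u = pt (cone A) k.
Proof. by elim/smk_ind: u => s x; rewrite cone_raiseE std1_max1; exact: smk_ptl. Qed.

Lemma cone_raise_pt (A : psset) k (t : std 1 k) :
  cone_raise t (pt (cone A) k) = pt (cone A) k.
Proof. by rewrite -(@smk_ptr I1 A k (simp_cst k ord0)) cone_raiseE !smk_ptr. Qed.

Lemma cone_raise_ga G (A : gpsset G) k g (t : std 1 k) (u : gsmash I1 A k) :
  cone_raise t (ga g u) = ga g (cone_raise t u : gsmash I1 A k).
Proof.
by elim/smk_ind: u => s x; rewrite gsmash_actE !cone_raiseE gsmash_actE.
Qed.

Lemma smash_map_equivariant G (B : psset) (A C : gpsset G) (f : psmap A C) :
  equivariant f -> @equivariant G (gsmash B A) (gsmash B C) (smash_map B f).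
Proof.
move=> fG k g; elim/smk_ind=> b x.
by rewrite gsmash_actE !smash_mapE gsmash_actE fG.
Qed.

Lemma bond_equivariant G (X : dspt G) n :
  @equivariant G (gsmash S1 (glevel X n)) (glevel X n.+1) (bond X n).
Proof.
move=> k g; elim/smk_ind=> s x; rewrite gsmash_actE.
by symmetry; exact: gact_bond.
Qed.

Lemma cone_in_equivariant G (A : gpsset G) :
  @equivariant G A (gsmash I1 A) (cone_in A).
Proof. by move=> k g x; symmetry; exact: gsmash_actE. Qed.

(* Factorization of r as a cofibration followed by a levelwise homotopy
   equivalence. Level n of the middle term is Y_n times the cone on D_n, where
   D_0 = X_0 and D_(n+1) is the pushout of X_(n+1) and the suspension of level n:
   embedding that pushout in its cone is what makes the first map a cofibration. *)
Section Cylinder.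
Variables (G : profiniteGroupType) (X Y : dspt G) (r : dmap X Y).

(** [st_obj] is D_n. Its map from X_n is carried along in the recursion because the pushout D_(n+1)
    is formed with it. *)
Record stage n := Stage {
  st_obj : gpsset G;
  st_in : psmap (X n) st_obj;
  st_inG : @equivariant G (glevel X n) st_obj st_in }.

Definition cyl n (s : stage n) : gpsset G :=
  gprod (glevel Y n) (gsmash I1 (st_obj s)).

Definition cyl_in n (s : stage n) : psmap (X n) (cyl s) :=
  pair_psmap (r n) (psmap_comp (cone_in (st_obj s)) (st_in s)).

Lemma cyl_inG n (s : stage n) : @equivariant G (glevel X n) (cyl s) (cyl_in s).
Proof.
move=> k g x; congr pair; first exact: dmap_gact.
by rewrite /= st_inG; exact: (@cone_in_equivariant G (st_obj s)).
Qed.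

Definition next_obj n (s : stage n) : gpsset G :=
  gpushout (@bond_equivariant G X n) (smash_map_equivariant (cyl_inG s)).

Definition next_inl n (s : stage n) : psmap (X n.+1) (next_obj s) :=
  po_inl (@bond_equivariant G X n) (smash_map_equivariant (cyl_inG s)).

Definition next_inr n (s : stage n) : psmap (smash S1 (cyl s)) (next_obj s) :=
  po_inr (@bond_equivariant G X n) (smash_map_equivariant (cyl_inG s)).

Definition next n (s : stage n) : stage n.+1 :=
  @Stage n.+1 (next_obj s) (next_inl s)
    (po_inl_equivariant (@bond_equivariant G X n)
      (smash_map_equivariant (cyl_inG s))).

Fixpoint stg n : stage n :=
  if n is m.+1 then next (stg m)
  else @Stage 0 (glevel X 0) (psmap_id (X 0)) (fun _ _ _ => erefl).

Definition cyl_bond n : psmap (smash S1 (cyl (stg n))) (cyl (stg n.+1)) :=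
  pair_psmap (psmap_comp (bond Y n) (smash_map S1 (pfst _ _)))
    (psmap_comp (cone_in (st_obj (stg n.+1))) (next_inr (stg n))).

Lemma cyl_bondE n k (s : S1 k) (x : cyl (stg n) k) :
  cyl_bond n k (smk s x) =
  (bond Y n k (smk s x.1),
   cone_in (st_obj (stg n.+1)) k (next_inr (stg n) k (smk s x))).
Proof. by congr pair; congr (bond Y n k _); exact: smash_mapE. Qed.

Lemma cyl_bond_ga n k g (s : S1 k) (x : cyl (stg n) k) :
  ga g (cyl_bond n k (smk s x) : cyl (stg n.+1) k) =
  cyl_bond n k (smk s (ga g x)).
Proof.
rewrite !cyl_bondE; congr pair; first exact: gact_bond.
rewrite -(@gsmash_actE G S1 (cyl (stg n)) k g s x).
rewrite [in RHS](po_inr_equivariant _ _).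
by symmetry; exact: (@cone_in_equivariant G (st_obj (stg n.+1))).
Qed.

Definition cylinder : dspt G.
Proof.
exists (Spectrum cyl_bond) (fun n k g x => @ga G (cyl (stg n)) k g x).
- abstract by move=> n k x; exact: ga1.
- abstract by move=> n k g h x; exact: gaM.
- abstract by move=> n l k f g x; exact: ga_sact.
- abstract by move=> n k g; exact: ga_pt.
- abstract by move=> n k g s x; exact: cyl_bond_ga.
- abstract by move=> n k x y; exact: ga_open.
Defined.

(** On the cone coordinate this is the gluing relation of the pushout D_(n+1). *)
Lemma cyl_in_bond n k (s : S1 k) (x : X n k) :
  cyl_in (stg n.+1) k (bond X n k (smk s x)) =
  cyl_bond n k (smk s (cyl_in (stg n) k x)).
Proof.
rewrite cyl_bondE; congr pair; first exact: spmap_bond.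
congr (cone_in (st_obj (stg n.+1)) k _).
rewrite -(smash_mapE (cyl_in (stg n))).
exact: (po_glue (@bond_equivariant G X n) (smash_map_equivariant (cyl_inG (stg n)))).
Qed.

Definition cylinder_in : dmap X cylinder.
Proof.
unshelve eexists (@SpMap X cylinder (fun n => cyl_in (stg n)) _).
- abstract by move=> n k s x; exact: cyl_in_bond.
- abstract by move=> n k g x; exact: cyl_inG.
Defined.

Definition cylinder_proj : dmap cylinder Y.
Proof.
unshelve eexists (@SpMap cylinder Y (fun n => pfst _ _) _).
- abstract by move=> n k s x; rewrite [bond cylinder n k _]cyl_bondE.
- abstract by [].
Defined.

Lemma cylinder_proj_in n k (x : X n k) :
  cylinder_proj n k (cylinder_in n k x) = r n k x.
Proof. by []. Qed.

(** The pushout whose map to level n+1 must be injective is D_(n+1) itself, and the second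
    coordinate of that map is the embedding of D_(n+1) in its cone. At level 0 the embedding of D_0
    = X_0 in its cone suffices. *)
Lemma cylinder_in_cofibration : cofibration cylinder_in.
Proof.
split=> [k x y /(congr1 snd) /cone_in_inj //|n k u v E].
apply: (@cone_in_inj (st_obj (stg n.+1))).
have key w : (cofib_map cylinder_in n k w).2 = cone_in (st_obj (stg n.+1)) k w.
  by elim/cls_ind: w => -[b|c]; rewrite [cofib_map _ _ _ _]squot_liftE.
by rewrite -!key E.
Qed.

(** A family of maps of levels and not a map of spectra: the bonding map sends (y, cone point) to
    the bottom of the next cone, in general not to its cone point. *)
Definition cylinder_sec n : psmap (Y n) (cylinder n).
Proof.
unshelve refine (@PSMap (Y n) (cylinder n) (@SMap (Y n) (cylinder n)
  (fun k y => (y, pt _ k)) _) _).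
- abstract (move=> l k f y; congr pair; symmetry; exact: (pt_sact (cone _))).
- abstract by [].
Defined.

Definition cylinder_htpy n : smap (sprod (cylinder n) (std 1)) (cylinder n).
Proof.
exists (fun k x => (x.1.1, cone_raise x.2 x.1.2)).
abstract by move=> l k f x; congr pair; exact: cone_raise_act.
Defined.
End Cylinder.

(** * Fixed points of trivial cofibrations between fibrant objects *)

Lemma dmap_fixed (G : profiniteGroupType) (X Y : dspt G) (f : dmap X Y)
    (S : set G) n k (x : X n k) :
  fixed S x -> fixed S (f n k x).
Proof. by move=> fx g Sg; rewrite -dmap_gact fx. Qed.

Definition fix_dmap (G : profiniteGroupType) (S : set G) (X Y : dspt G) (f : dmap X Y) :
  spmap (fixsp X S) (fixsp Y S) := fix_map (f := f) (@dmap_fixed G X Y f S).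

Section CylinderEquiv.
Variables (G : profiniteGroupType) (X Y : dspt G) (r : dmap X Y).
Let C := cylinder r.

Lemma cylinder_htpyE n :
  [/\ forall k t, cylinder_htpy r n k (pt (C n) k, t) = pt (C n) k,
      forall k x, cylinder_htpy r n k (x, simp_cst k ord0) = x
    & forall k x, cylinder_htpy r n k (x, simp_cst k ord_max) =
        cylinder_sec r n k (cylinder_proj r n k x)].
Proof.
split=> k x; first by congr pair; exact: cone_raise_pt.
- by case: x => y u; congr pair; exact: cone_raise0.
- by case: x => y u; congr pair; exact: cone_raise1.
Qed.

Lemma cylinder_htpy_gact n k g x t :
  cylinder_htpy r n k (gact g (x : C n k), t) =
  gact g (cylinder_htpy r n k (x, t)).
Proof. by congr pair; exact: cone_raise_ga. Qed.

Lemma cylinder_sec_gact n k g (y : Y n k) :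
  cylinder_sec r n k (gact g y) = gact g (cylinder_sec r n k y).
Proof. by congr pair; symmetry; exact: (ga_pt (gsmash I1 _)). Qed.

Lemma cylinder_proj_equiv : stable_equiv (cylinder_proj r).
Proof.
apply: (@levelwise_stable_equiv _ _ _ (cylinder_sec r)) => // n.
by have [hpt h0 h1] := cylinder_htpyE n; exists (cylinder_htpy r n).
Qed.

(** The section and the contraction of the cones commute with G, so both restrict to the S-fixed
    points. A general stable equivalence has no such property; this is the reason for factoring
    through the cylinder. *)
Lemma fix_cylinder_proj_equiv S : stable_equiv (fix_dmap S (cylinder_proj r)).
Proof.
have secP n k (y : fix_psset Y S n k) : fixed S (cylinder_sec r n k (sval y)).
  by move=> g Sg; rewrite -cylinder_sec_gact (svalP y _ Sg).
have htpyP n k (x : fix_psset C S n k) t :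
    fixed S (cylinder_htpy r n k (sval x, t)).
  by move=> g Sg; rewrite -cylinder_htpy_gact (svalP x _ Sg).
have sec_nat n l k (f : simp l k) (y : fix_psset Y S n k) :
    exist _ _ (secP n l (sact f y)) =
    sact f (exist _ _ (secP n k y) : fix_psset C S n k).
  by apply: fix_eq; exact: smap_nat.
have sec_pt n k : exist _ _ (secP n k (pt _ k)) = pt (fix_psset C S n) k.
  exact: fix_eq.
have htpy_nat n l k (f : simp l k) (x : sprod (fix_psset C S n) (std 1) k) :
    exist _ _ (htpyP n l (sact f x.1) (sact f x.2)) =
    sact f (exist _ _ (htpyP n k x.1 x.2) : fix_psset C S n k).
  apply: fix_eq.
  exact: (smap_nat (cylinder_htpy r n) f (sval x.1, x.2)).
pose sec n : smap (fix_psset Y S n) (fix_psset C S n) :=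
  @SMap (fix_psset Y S n) (fix_psset C S n)
    (fun k y => exist _ _ (secP n k y)) (sec_nat n).
pose htpy n : smap (sprod (fix_psset C S n) (std 1)) (fix_psset C S n) :=
  @SMap (sprod (fix_psset C S n) (std 1)) (fix_psset C S n)
    (fun k x => exist _ _ (htpyP n k x.1 x.2)) (htpy_nat n).
apply: (@levelwise_stable_equiv _ _ (fix_dmap S (cylinder_proj r))
  (fun n => @PSMap (fix_psset Y S n) (fix_psset C S n) (sec n) (sec_pt n))).
  by move=> n k y; exact: fix_eq.
move=> n; have [hpt h0 h1] := cylinder_htpyE n; exists (htpy n).
by split=> k x; apply: fix_eq; [exact: hpt|exact: h0|exact: h1].
Qed.
End CylinderEquiv.

Definition dmap_id G (X : dspt G) : dmap X X :=
  @DMap G X X (spmap_id X) (fun _ _ _ _ => erefl).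

(* Whitehead: let q be a retraction of i. Since q factors as p j with j a
   trivial cofibration, id extends along j; hence j is split injective on fixed
   points, where p is still an equivalence, and so q is injective. *)
Lemma fix_trivial_cofibration_equiv (G : profiniteGroupType) (S : set G)
    (X Y : dspt G) (i : dmap X Y) :
  fibrant X -> fibrant Y -> trivial_cofibration i ->
  stable_equiv (fix_dmap S i).
Proof.
move=> fX fY [ci ei].
(* Since X is fibrant, its identity extends along i. *)
have [q qi] := fX _ _ i (conj ci ei) (dmap_id X).
have eq_q : stable_equiv q.
  move=> d; apply: (bij_can_bij (ei d)); exact: stable_pi_map_cancel qi d.
pose j := cylinder_in q; pose p := cylinder_proj q.
have pj n k x : spmap_comp p j n k x = q n k x by exact: cylinder_proj_in.
(* Two out of three for q = p j; fibrancy of Y then gives a retraction s of j. *)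
have ej : stable_equiv j.
  move=> d; have [p' pK p'K] := cylinder_proj_equiv q d.
  apply: (@eq_bij _ _ (p' \o @stable_pi_map _ _ q d)).
    by apply: bij_comp (eq_q d); exists (@stable_pi_map _ _ p d).
  by move=> x; rewrite /= -(stable_pi_map_ext pj) stable_pi_map_comp pK.
have [s sj] := fY _ _ j (conj (cylinder_in_cofibration q) ej) (dmap_id Y).
move=> d; exists (@stable_pi_map _ _ (fix_dmap S q) d).
  by apply: stable_pi_map_cancel => n k x; apply: fix_eq; exact: qi.
have q_inj : injective (@stable_pi_map _ _ (fix_dmap S q) d).
  apply: (@eq_inj _ _ (@stable_pi_map _ _ (fix_dmap S p) d \o
      @stable_pi_map _ _ (fix_dmap S j) d)).
    apply: inj_comp; first exact/bij_inj/fix_cylinder_proj_equiv.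
    apply: can_inj.
    apply: (@stable_pi_map_cancel _ _ (fix_dmap S j) (fix_dmap S s) _ d) => n k x.
    by apply: fix_eq; exact: sj.
  move=> x; rewrite /= -stable_pi_map_comp; apply: stable_pi_map_ext => n k y.
  by apply: fix_eq; exact: pj.
(* By injectivity of q, the remaining identity i q = id follows from q i q = q. *)
move=> y; apply: q_inj; move: (stable_pi_map _ y) => x.
by apply: stable_pi_map_cancel => n k z; apply: fix_eq; exact: qi.
Qed.

(** * Open normal subgroups and stabilizers *)

Definition on_meet (G : profiniteGroupType) (N N' : openNormal G) : openNormal G.
Proof.
exists (on_set N `&` on_set N').
- abstract (by apply: openI; exact: on_open).
- abstract by split; exact: on_1.
- abstract by move=> x y [Nx N'x] [Ny N'y]; split; exact: on_M.
- abstract by move=> x [Nx N'x]; split; exact: on_V.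
- abstract by move=> g x [Nx N'x]; split; exact: on_J.
Defined.

Lemma conj_continuous (G : profiniteGroupType) :
  continuous (fun p : G * G => p.1 ^ p.2).
Proof.
move=> p; apply: (@continuous_comp _ _ _ (fun p : G * G => (p.2^-1, p.1 * p.2))
  (fun q : G * G => q.1 * q.2)); last exact: mulg_continuous.
apply: cvg_pair; last exact: mulg_continuous.
by apply: (@cvg_comp _ _ _ snd (fun x : G => x^-1));
  [exact: cvg_snd|exact: invg_continuous].
Qed.

(* The complement of the core is the image of a closed subset of the compact
   space G * G under the first projection. *)
Lemma open_core (G : profiniteGroupType) (S : set G) :
  open S -> open [set x | forall g, S (x ^ g)].
Proof.
move=> oS; have -> : [set x | forall g, S (x ^ g)] =
    ~` (fst @` [set p : G * G | ~ S (p.1 ^ p.2)]).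
  apply/seteqP; split=> x /=; first by move=> Sx [[y g] /= nS yx]; apply: nS; rewrite yx.
  by move=> nx g; apply: contrapT => nS; apply: nx; exists (x, g).
apply: closed_openC; apply: compact_closed; first exact: profinite_hausdorff.
apply: continuous_compact; first by apply: continuous_subspaceT => p; exact: cvg_fst.
have cGG : compact [set: G * G].
  by rewrite -setXTT; apply: compact_setX; exact: profinite_compact.
apply: (subclosed_compact _ cGG) => //.
apply: (@closed_comp _ _ (fun p : G * G => p.1 ^ p.2) (~` S)); last exact: open_closedC.
by move=> p _; exact: conj_continuous.
Qed.

(** The stabilizer of x is open because Z is discrete, and its normal core is still open by
    compactness of G. *)
Lemma open_normal_stabilizer (G : profiniteGroupType) (Z : dspt G) n k (x : Z n k) :
  exists N : openNormal G, fixed (on_set N) x.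
Proof.
pose St := [set g | gact g x = x].
have St1 : St 1 by exact: gact1.
have StM a b : St a -> St b -> St (a * b) by rewrite /St /= gactM => aE ->.
have StV a : St a -> St a^-1.
  by rewrite /St /= => aE; rewrite -{1}aE -gactM mulVg gact1.
unshelve eexists (@OpenNormal G [set y | forall g, St (y ^ g)] _ _ _ _ _).
- exact/open_core/gact_continuous.
- by move=> g; rewrite conj1g.
- by move=> a b Sa Sb g; rewrite conjMg; exact: StM.
- by move=> a Sa g; rewrite conjVg; exact: StV.
- by move=> g a Sa h; rewrite -conjgM.
- by move=> a /(_ 1); rewrite conjg1.
Qed.

(** * The colimit of the Z^{NH} as Z^H, its fibrancy and its fixed points *)

Section ColimFixEmbedding.
Variables (G : profiniteGroupType) (Z : dspt G) (H : closedSubgroup G).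
Hypothesis nH : normal_subgroup H.
Let W := colim_fix_dspt Z nH.

Definition fix_sub (S : set G) : spmap (fixsp Z S) Z.
Proof.
unshelve refine (@SpMap (fixsp Z S) Z (fun n => @PSMap (fixsp Z S n) (Z n)
  (@SMap (fixsp Z S n) (Z n) (fun k x => sval x) _) _) _).
- abstract by [].
- abstract by [].
- abstract by move=> n k s x; exact: fix_bondE.
Defined.

Definition colim_emb : spmap W Z :=
  spmap_comp (fix_sub (cs_set H)) (colim_fix_map Z (cs_set H)).

Lemma colim_embE N n k (x : fixsp Z (NH (cs_set H) N) n k) :
  colim_emb n k (cfin x) = sval x.
Proof.
rewrite -[LHS]/(sval (colim_fix_map Z (cs_set H) n k (cfin x))).
by rewrite [colim_fix_map _ _ _ _ _]squot_liftE.
Qed.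

(** The transition maps are inclusions inside Z, and two indices N and N' have the common refinement
    given by their intersection. *)
Lemma colim_emb_inj n k : injective (colim_emb n k).
Proof.
elim/cfin_ind=> N x; elim/cfin_ind=> N' x'; rewrite !colim_embE => xx'.
have le : on_le N (on_meet N N') by move=> a [].
have le' : on_le N' (on_meet N N') by move=> a [].
rewrite /cfin -(colin_le (openNormalT G) (fix_incl Z (cs_set H)) le).
rewrite -(colin_le (openNormalT G) (fix_incl Z (cs_set H)) le').
by congr colin; exact: fix_eq.
Qed.

Lemma colim_emb_gact n k g (w : W n k) :
  colim_emb n k (gact (qproj nH g) w) = gact g (colim_emb n k w).
Proof.
rewrite -[gact _ w]/(cf_act (qproj nH g) w) cf_actE.
by elim/cfin_ind: w => N x; rewrite cf_act_repE !colim_embE.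
Qed.

(** A simplex fixed by H is also fixed by some open normal N, hence by NH. With injectivity, this
    identifies W with Z^H. *)
Lemma colim_emb_surj n k (z : Z n k) :
  fixed (cs_set H) z -> exists w, colim_emb n k w = z.
Proof.
move=> fz; have [N Nz] := open_normal_stabilizer z.
have fNz : fixed (NH (cs_set H) N) z.
  by move=> _ [a Na [h Hh <-]]; rewrite gactM fz // Nz.
by exists (cfin (exist _ z fNz)); rewrite colim_embE.
Qed.

Section Factor.
Variables (B : spectrum) (f : spmap B Z).
Hypothesis fH : forall n k b, fixed (cs_set H) (f n k b).

(** Preimages are picked by choice, but injectivity of [colim_emb] makes them unique; every
    compatibility of the factorization is therefore checked in Z. *)
Definition colim_factor_fun n k (b : B n k) : W n k :=
  projT1 (cid (colim_emb_surj (fH b))).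

Lemma colim_factor_funE n k (b : B n k) :
  colim_emb n k (colim_factor_fun b) = f n k b.
Proof. by rewrite /colim_factor_fun; case: cid. Qed.

Definition colim_factor : spmap B W.
Proof.
unshelve refine (@SpMap B W (fun n => @PSMap (B n) (W n) (@SMap (B n) (W n)
  (fun k b => colim_factor_fun b) _) _) _).
- abstract (move=> l k h b; apply: colim_emb_inj;
    by rewrite (smap_nat (colim_emb n)) !colim_factor_funE smap_nat).
- abstract (move=> k; apply: colim_emb_inj;
    by rewrite colim_factor_funE !psmap_pt).
- abstract (move=> n k s b; apply: colim_emb_inj;
    by rewrite (spmap_bond colim_emb) !colim_factor_funE spmap_bond).
Defined.
End Factor.

Definition inflation (B : dspt (quotg nH)) : dspt G.
Proof.
exists (dspt_spectrum B) (fun n k g x => gact (qproj nH g) x).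
- abstract by move=> n k x; exact: gact1.
- abstract by move=> n k g h x; rewrite -qproj_mul; exact: gactM.
- abstract by move=> n l k f g x; exact: gact_sact.
- abstract by move=> n k g; exact: gact_pt.
- abstract by move=> n k g s x; exact: gact_bond.
- abstract (move=> n k x y;
    exact: (iffLR (open_quotgP [set q : quotg nH | gact q x = y])
      (gact_continuous x y))).
Defined.

Definition inflation_map (A B : dspt (quotg nH)) (f : dmap A B) :
  dmap (inflation A) (inflation B) :=
  @DMap G (inflation A) (inflation B) f (fun n k g x => dmap_gact f (qproj nH g) x).

(* H-fixed points have a left adjoint, inflation, which changes neither the
   underlying spectra nor the trivial cofibrations. *)
Lemma colim_fix_fibrant : fibrant Z -> fibrant W.
Proof.
move=> fZ A B i [ci ei] f.
have embf_gact n k g (a : inflation A n k) :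
    spmap_comp colim_emb f n k (gact g a) = gact g (spmap_comp colim_emb f n k a).
  by rewrite /= -colim_emb_gact -dmap_gact.
have [g gi] := fZ _ _ (inflation_map i) (conj ci ei)
  (@DMap G (inflation A) Z (spmap_comp colim_emb f) embf_gact).
(* H acts trivially on an inflated spectrum, so the extension takes values in Z^H and factors
   through W. *)
have gH n k (b : B n k) : fixed (cs_set H) (g n k b).
  move=> h Hh; rewrite -dmap_gact; congr (g n k _).
  rewrite -[LHS]/(gact (qproj nH h) b).
  have -> : qproj nH h = 1 by apply/qprojP; rewrite mulg1; exact: cs_V.
  exact: gact1.
have fac_gact n k q (b : B n k) :
    colim_factor gH n k (gact q b) = gact q (colim_factor gH n k b).
  elim/qproj_ind: q => x; apply: colim_emb_inj.
  rewrite colim_emb_gact !colim_factor_funE.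
  exact: (dmap_gact g x (b : inflation B n k)).
exists (DMap fac_gact) => n k a; apply: colim_emb_inj.
by rewrite [LHS]colim_factor_funE; exact: gi.
Qed.

Lemma colim_emb_setT n k (w : W n k) : fixed setT w -> fixed setT (colim_emb n k w).
Proof. by move=> fw g _; rewrite -colim_emb_gact fw. Qed.

(* (Z^H)^(G/H) = Z^G *)
Lemma fix_colim_emb_equiv : stable_equiv (fix_map colim_emb_setT).
Proof.
(* What is G-fixed is H-fixed, so the inclusion of Z^G in Z lifts to W, with G/H-fixed values. This
   lift is a strict inverse. *)
have ZH n k (z : fixsp Z setT n k) : fixed (cs_set H) (fix_sub setT n k z).
  by move=> h _; exact: (svalP z).
have fG n k (z : fixsp Z setT n k) : fixed setT (colim_factor ZH n k z).
  move=> q _; elim/qproj_ind: q => g; apply: colim_emb_inj.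
  by rewrite colim_emb_gact !colim_factor_funE; exact: (svalP z).
pose u n k (z : fixsp Z setT n k) : fixsp W setT n k := exist _ _ (fG n k z).
have u_nat n l k (f : simp l k) (z : fixsp Z setT n k) :
    u n l (sact f z) = sact f (u n k z).
  by apply: fix_eq; exact: smap_nat.
have u_pt n k : u n k (pt (fixsp Z setT n) k) = pt (fixsp W setT n) k.
  by apply: fix_eq; exact: psmap_pt.
have u_bond n k s (z : fixsp Z setT n k) :
    u n.+1 k (bond (fixsp Z setT) n k (smk s z)) =
    bond (fixsp W setT) n k (smk s (u n k z)).
  by apply: fix_eq; rewrite fix_bondE -spmap_bond.
pose v n := @PSMap (fixsp Z setT n) (fixsp W setT n)
  (@SMap (fixsp Z setT n) (fixsp W setT n) (u n) (u_nat n)) (u_pt n).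
pose lift := @SpMap (fixsp Z setT) (fixsp W setT) v u_bond.
move=> d; exists (@stable_pi_map _ _ lift d).
  apply: stable_pi_map_cancel => n k w; apply: fix_eq; apply: colim_emb_inj.
  exact: colim_factor_funE.
by apply: stable_pi_map_cancel => n k z; apply: fix_eq; exact: colim_factor_funE.
Qed.
End ColimFixEmbedding.

(** * Comparison of iterated and ordinary homotopy fixed points *)

(** The zigzag is (W_f)^{G/H} <- W^{G/H} -> Z^G, through the strict fixed points of W. *)
Lemma iterated_hfix_equiv (fr : fibrant_replacements) (G : profiniteGroupType)
    (X : dspt G) (H : closedSubgroup G) (nH : normal_subgroup H) :
  weakly_equivalent (iterated_hfix fr X nH) (hfix fr X).
Proof.
set Z := fr_obj (fr G X); set W := colim_fix_dspt Z nH.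
have fW : fibrant W by exact/colim_fix_fibrant/fr_fibrant.
apply: (@rst_trans _ _ _ (fixsp W setT)); last first.
  apply: rst_step; eexists; exact: fix_colim_emb_equiv.
apply: rst_sym; apply: rst_step; exists (fix_dmap setT (fr_map (fr _ W))).
apply: fix_trivial_cofibration_equiv fW _ _; first exact: fr_fibrant.
exact: fr_trivial_cofibration.
Qed.

Unset Implicit Arguments.

Theorem lemma4p9 (fr : fibrant_replacements) (G : profiniteGroupType)
    (X : dspt G) (K : closedSubgroup G)
    (hX : hyperfibrant fr (dres K X))
    (H : closedSubgroup G) (sHK : cs_set H `<=` cs_set K)
    (nHK : normal_subgroup (sub_in K H)) :
  weakly_equivalent (iterated_hfix fr (dres K X) nHK) (hfix fr (dres K X)).
Proof. exact: iterated_hfix_equiv. Qed.
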